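(* Let $(\Sigma,\mathcal{B},\mu)$ be a measure space and $H=L^2(\Sigma)$. Let $V_1$ and $V_2$ be two real locally convex topological vector spaces, and let $j_1:V_1\to L^2(\Sigma)$ and $j_2:V_2\to L^2(\Sigma)$ be two linear operators which are weak-to-weak continuous. Let $\varphi_1:V_1\to\mathbb{R}\cup\{+\infty\}$ and $\varphi_2:V_2\to\mathbb{R}\cup\{+\infty\}$ be two convex, proper, lower semicontinuous functionals which are, respectively, $j_1$- and $j_2$-elliptic. Assume that $j_1(D(\varphi_1))$ and $j_2(D(\varphi_2))$ are dense in $L^2(\Sigma)$, and let $S_1$ and $S_2$ be the semigroups on $L^2(\Sigma)$ generated by $(\varphi_1,j_1)$ and $(\varphi_2,j_2)$, respectively. Suppose that $S_2$ is positive and order preserving on $L^2(\Sigma)^+$. Then the following assertions are equivalent: (1) $S_1$ is dominated by $S_2$. (2) For every $u_1\in L^2(\Sigma)$, $u_2\in L^2(\Sigma)^+$ one has $$\varphi_1^H\big((|u_1|\wedge u_2)\,\mathrm{sign}(u_1)\big)+\varphi_2^H(|u_1|\vee u_2)\le\varphi_1^H(u_1)+\varphi_2^H(u_2).$$ (3) For every $\hat u_1\in D(\varphi_1)$ with $u_1:=j_1(\hat u_1)$ and every $\hat u_2\in D(\varphi_2)$ with $u_2:=j_2(\hat u_2)\in L^2(\Sigma)^+$ there are $\hat v_1\in D(\varphi_1)$, $\hat v_2\in D(\varphi_2)$ such that $$(|u_1|\wedge u_2)\,\mathrm{sign}(u_1)=j_1(\hat v_1),\qquad |u_1|\vee u_2=j_2(\hat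 v_2),$$ and $\varphi_1(\hat v_1)+\varphi_2(\hat v_2)\le\varphi_1(\hat u_1)+\varphi_2(\hat u_2)$.
   Context: For a real locally convex space $V$, a linear weak-to-weak continuous $j:V\to H$ and $\varphi:V\to\mathbb{R}\cup\{+\infty\}$: $D(\varphi)=\{\varphi<+\infty\}$; $\varphi$ is proper if $D(\varphi)\neq\emptyset$, lower semicontinuous if all sublevels $\{\varphi\le c\}$, $c\in\mathbb{R}$, are closed, and coercive if all sublevels are relatively weakly compact; $\varphi$ is $j$-elliptic if there exists $\omega\ge 0$ such that $\hat u\mapsto\varphi(\hat u)+\frac{\omega}{2}\|j(\hat u)\|_H^2$ is convex and coercive. The $j$-subgradient of $\varphi$ is $$\partial_j\varphi=\Big\{(u,f)\in H\times H \;:\; \exists\,\hat u\in D(\varphi)\text{ with } j(\hat u)=u \text{ and, for every }\hat v\in V,\ \liminf_{t\searrow 0}\frac{\varphi(\hat u+t\hat v)-\varphi(\hat u)}{t}\ge\langle f,j(\hat v)\rangle_H\Big\}.$$ $\partial\psi$ denotes the classical subgradient of a functional $\psi$ on $H$ (the case $V=H$, $j=I$). For $i=1,2$, $\varphi_i^H:H\to\mathbb{R}\cup\{+\infty\}$ denotes a convex, proper, lower semicontinuous functional with $\partial_{j_i}\varphi_i\subseteq\partial\varphi_i^H$; it exists, is unique up to an additive constant, and modulo that constant $\varphi_i^H(u)=\inf\{\varphi_i(\hat u): j_i(\hat u)=u\}$. The semigroup generated by $(\varphi,j)$: for every $u_0\in\overline{j(D(\varphi))}$ (here all of $L^2(\Sigma)$)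 the problem $\dot u+\partial_j\varphi(u)\ni 0$ a.e. on $(0,\infty)$, $u(0)=u_0$, has a unique solution $u\in C(\mathbb{R}_+;H)\cap W^{1,\infty}_{loc}((0,\infty);H)$, and $S(t)u_0:=u(t)$. $L^2(\Sigma)$ (real-valued) carries the natural almost everywhere ordering with lattice operations $\wedge,\vee$ and absolute value $|\cdot|$, and $L^2(\Sigma)^+$ is the set of $u\ge 0$. A semigroup $S$ is positive if $S(t)u\ge 0$ for all $u\ge 0$, $t\ge 0$; it is order preserving on $C$ if $u,v\in C$, $u\le v$ imply $S(t)u\le S(t)v$ for all $t\ge 0$. $S_1$ is dominated by $S_2$ (written $S_1\preccurlyeq S_2$) if $S_2$ is positive and $|S_1(t)u|\le S_2(t)|u|$ for every $u\in L^2(\Sigma)$ and every $t\ge 0$. *)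

(* Defs.v *)
From HB Require Import structures.
From mathcomp Require Import all_boot all_order all_algebra.
From mathcomp Require Import all_classical all_reals all_analysis.
From mathcomp Require Import measurable_realfun.

Set Implicit Arguments.
Unset Strict Implicit.
Unset Printing Implicit Defensive.

Import Order.TTheory GRing.Theory Num.Def Num.Theory.
Import numFieldNormedType.Exports.

Local Open Scope classical_set_scope.
Local Open Scope ring_scope.

(* [L2 mu] is the library's quotient [LspaceType2 mu] of the square-integrable
   functions by almost everywhere equality; the library gives it no algebraic
   structure, so the normed space structure is built here, on representatives. *)
Section L2.
Context d (T : measurableType d) (R : realType).
Variable mu : {measure set T -> \bar R}.

Definition L2 : Type := LspaceType2 mu.

HB.instance Definition _ := gen_eqMixin L2.
HB.instance Definition _ := gen_choiceMixin L2.

Definition L2fun (u : L2) : T -> R := repr (LebesgueSpace.sort u).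

Implicit Types (u v w : L2) (f g : T -> R).

Lemma L2fun_measurable u : measurable_fun setT (L2fun u).
Proof.
by rewrite /L2fun; exact: (measurable_funPT (repr (LebesgueSpace.sort u))).
Qed.

Lemma L2fun_Lfun u : L2fun u \in Lfun mu 2%:E.
Proof.
apply/andP; rewrite !inE/=; split; first exact: L2fun_measurable.
rewrite /L2fun; exact: Lebesgue_finite.
Qed.

Lemma Lfun2_measurable f : f \in Lfun mu 2%:E -> measurable_fun setT f.
Proof. by move=> /andP[]; rewrite inE. Qed.

Lemma Lfun2_le f g : measurable_fun setT f -> g \in Lfun mu 2%:E ->
  {ae mu, forall x, `|f x| <= `|g x|} -> f \in Lfun mu 2%:E.
Proof.
move=> mf /andP[]; rewrite !inE/= => mg fg fleg.
apply/andP; rewrite !inE/=; split => //.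
apply: le_lt_trans fg; rewrite unlock /Lnorm.
apply: gt0_ler_poweR => //.
- by rewrite in_itv/= leey integral_ge0// => x _; exact: poweR_ge0.
- by rewrite in_itv/= leey integral_ge0// => x _; exact: poweR_ge0.
have mp (h : T -> R) : measurable_fun setT h ->
    measurable_fun [set: T] (EFin \o (fun x => `|h x| `^ 2) : T -> \bar R).
  move=> mh; apply/measurable_EFinP; apply: (measurableT_comp (measurable_powR _)).
  exact: measurableT_comp.
apply: ae_ge0_le_integral => //; try (by move=> *; exact: poweR_ge0).
- exact: mp.
- exact: mp.
apply: filterS fleg => x /= fgx _.
by rewrite lee_fin ge0_ler_powR ?nnegrE.
Qed.

Section mkL2.
Variables (f : T -> R) (hf : f \in Lfun mu 2%:E).

Let mf : {mfun T >-> measurableTypeR R} :=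
  HB.pack_for {mfun T >-> measurableTypeR R} (f : T -> measurableTypeR R)
   (@isMeasurableFun.Build _ _ T (measurableTypeR R) f (Lfun2_measurable hf)).

Local Notation mfunQ := {mfun_ mu, T >-> measurableTypeR R}.

Let cf : mfunQ := \pi_mfunQ%qT mf.

Let cfE : {ae mu, forall x, (repr cf : T -> R) x = f x}.
Proof.
have : (repr cf == mf %[mod mfunQ])%qT by rewrite reprK.
by rewrite eqmodE => /asboolP; apply: filterS => x /=; apply.
Qed.

Let cffin : finite_norm mu 2%:E (repr cf : T -> R).
Proof.
have : (repr cf : T -> R) \in Lfun mu 2%:E.
  apply: (Lfun2_le _ hf); first exact: (measurable_funPT (repr cf)).
  by apply: filterS cfE => x ->.
by move=> /andP[_]; rewrite inE.
Qed.

Definition mkL2 : L2 :=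
  HB.pack_for (LspaceType2 mu) cf
   (@isFinLebesgue.Build _ T R mu 2%:E (lee1n 2) cf cffin).

Lemma mkL2E : {ae mu, forall x, L2fun mkL2 x = f x}.
Proof. exact: cfE. Qed.
End mkL2.

Lemma L2_eq u v : {ae mu, forall x, L2fun u x = L2fun v x} -> u = v.
Proof.
case: u v => [f [[hf]]] [g [[hg]]] fg.
have fgE : f = g.
  apply/eqP; rewrite -[f]reprK -[g]reprK; rewrite eqmodE; apply/asboolP.
  by apply: filterS fg => x + _.
by subst g; rewrite (Prop_irrelevance hf hg).
Qed.

Lemma Lfun2_cst0 : cst 0 \in Lfun mu 2%:E.
Proof.
have [] := Lfun_submod_closed mu (lee1n 2 : (1 <= (2%:E : \bar R))%E).
by move=> h _; exact: h.
Qed.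

Lemma Lfun2D f g : f \in Lfun mu 2%:E -> g \in Lfun mu 2%:E ->
  (fun x => f x + g x) \in Lfun mu 2%:E.
Proof.
have [_] := Lfun_addr_closed mu (lee1n 2 : (1 <= (2%:E : \bar R))%E).
exact.
Qed.

Lemma Lfun2Z (a : R) f : f \in Lfun mu 2%:E ->
  (fun x => a * f x) \in Lfun mu 2%:E.
Proof.
move=> hf; rewrite (_ : (fun _ => _) = a \o* f); last first.
  by apply/funext => x; rewrite /= mulrC.
by apply: Lfun_scale hf; rewrite ler1n.
Qed.

Lemma Lfun2_norm f : f \in Lfun mu 2%:E -> (fun x => `|f x|) \in Lfun mu 2%:E.
Proof.
move=> hf; apply: (Lfun2_le _ hf); last by apply: aeW => x /=; rewrite normr_id.
by apply: measurableT_comp => //; exact: Lfun2_measurable.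
Qed.

Definition L2zero : L2 := mkL2 Lfun2_cst0.

Definition L2add u v : L2 := mkL2 (Lfun2D (L2fun_Lfun u) (L2fun_Lfun v)).

Definition L2scale (a : R) u : L2 := mkL2 (Lfun2Z a (L2fun_Lfun u)).

Definition L2opp u : L2 := L2scale (-1) u.

Lemma L2addE u v :
  {ae mu, forall x, L2fun (L2add u v) x = L2fun u x + L2fun v x}.
Proof. exact: mkL2E. Qed.

Lemma L2scaleE (a : R) u :
  {ae mu, forall x, L2fun (L2scale a u) x = a * L2fun u x}.
Proof. exact: mkL2E. Qed.

Lemma L2zeroE : {ae mu, forall x, L2fun L2zero x = 0}.
Proof. exact: mkL2E. Qed.

Lemma L2addC : commutative L2add.
Proof.
move=> u v; apply: L2_eq.
by apply: filterS2 (L2addE u v) (L2addE v u) => x -> ->; rewrite addrC.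
Qed.

Lemma L2addA : associative L2add.
Proof.
move=> u v w; apply: L2_eq; near=> x.
rewrite (near (L2addE u (L2add v w)) x)// (near (L2addE (L2add u v) w) x)//.
by rewrite (near (L2addE v w) x)// (near (L2addE u v) x)// addrA.
Unshelve. all: by end_near. Qed.

Lemma L2add0 : left_id L2zero L2add.
Proof.
move=> u; apply: L2_eq.
by apply: filterS2 (L2addE L2zero u) L2zeroE => x -> ->; rewrite add0r.
Qed.

Lemma L2addN : left_inverse L2zero L2opp L2add.
Proof.
move=> u; apply: L2_eq.
apply: filterS3 (L2addE (L2opp u) u) (L2scaleE (-1) u) L2zeroE => x -> -> ->.
by rewrite mulN1r addNr.
Qed.

HB.instance Definition _ :=
  GRing.isZmodule.Build L2 L2addA L2addC L2add0 L2addN.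

Lemma L2scaleA (a b : R) u : L2scale a (L2scale b u) = L2scale (a * b) u.
Proof.
apply: L2_eq; apply: filterS3 (L2scaleE a (L2scale b u)) (L2scaleE b u)
  (L2scaleE (a * b) u) => x -> -> ->.
by rewrite mulrA.
Qed.

Lemma L2scale1 : left_id 1 L2scale.
Proof.
move=> u; apply: L2_eq; apply: filterS (L2scaleE 1 u) => x ->.
by rewrite mul1r.
Qed.

Lemma L2scaleDr : right_distributive L2scale +%R.
Proof.
move=> a u v; apply: L2_eq; near=> x.
rewrite (near (L2scaleE a (u + v)) x)// (near (L2addE u v) x)//.
rewrite (near (L2addE (L2scale a u) (L2scale a v)) x)//.
by rewrite (near (L2scaleE a u) x)// (near (L2scaleE a v) x)// mulrDr.
Unshelve. all: by end_near. Qed.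

Lemma L2scaleDl u : {morph L2scale^~ u : a b / a + b}.
Proof.
move=> a b; apply: L2_eq; near=> x.
rewrite (near (L2scaleE (a + b) u) x)//.
rewrite (near (L2addE (L2scale a u) (L2scale b u)) x)//.
by rewrite (near (L2scaleE a u) x)// (near (L2scaleE b u) x)// mulrDl.
Unshelve. all: by end_near. Qed.

HB.instance Definition _ := GRing.Zmodule_isLmodule.Build R L2
  L2scaleA L2scale1 L2scaleDr L2scaleDl.

Definition L2norm u : R := fine (Lnorm mu 2%:E (EFin \o L2fun u)).

Definition L2dot u v : R := \int[mu]_x (L2fun u x * L2fun v x).

Lemma eq_ae_Lnorm2 f g : f \in Lfun mu 2%:E -> g \in Lfun mu 2%:E ->
  {ae mu, forall x, f x = g x} ->
  Lnorm mu 2%:E (EFin \o f) = Lnorm mu 2%:E (EFin \o g).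
Proof.
move=> hf hg fg; rewrite unlock /Lnorm; congr (_ `^ _)%E.
have mp (h : T -> R) : h \in Lfun mu 2%:E ->
    measurable_fun [set: T] (EFin \o (fun x => `|h x| `^ 2) : T -> \bar R).
  move=> mh; apply/measurable_EFinP; apply: (measurableT_comp (measurable_powR _)).
  by apply: measurableT_comp => //; exact: Lfun2_measurable.
apply: ae_eq_integral => //; [exact: mp|exact: mp|].
by apply: filterS fg => x /= ->.
Qed.

Lemma L2norm_mk f (hf : f \in Lfun mu 2%:E) :
  L2norm (mkL2 hf) = fine (Lnorm mu 2%:E (EFin \o f)).
Proof.
by congr fine; apply: eq_ae_Lnorm2 (mkL2E hf) => //; exact: L2fun_Lfun.
Qed.

Lemma L2norm_triangle u v : L2norm (u + v) <= L2norm u + L2norm v.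
Proof.
rewrite L2norm_mk.
exact: (ler_LnormD (Lfun_Sub (lee1n 2) (L2fun_Lfun u)) (Lfun_Sub (lee1n 2) (L2fun_Lfun v))).
Qed.

Lemma L2normZ (a : R) u : L2norm (a *: u) = `|a| * L2norm u.
Proof.
rewrite L2norm_mk.
have /= -> := LnormZ (Lfun_Sub (lee1n 2) (L2fun_Lfun u)) a.
rewrite fineM//.
have := finite_norm_fine (Lfun_Sub (lee1n 2) (L2fun_Lfun u)).
by move=> /= <-.
Qed.

Lemma L2norm_eq0 u : L2norm u = 0 -> u = 0.
Proof.
move=> /(@fine_Lnormr_eq0 _ _ _ mu _ (lee1n 2) (Lfun_Sub (lee1n 2) (L2fun_Lfun u))).
move=> u0; apply: L2_eq.
by apply: filterS2 u0 L2zeroE => x /= /(_ I) -> ->.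
Qed.

HB.instance Definition _ := @Lmodule_isNormed.Build R L2
  L2norm L2norm_triangle L2normZ L2norm_eq0.

Lemma L2normE u : `|u| = fine (Lnorm mu 2%:E (EFin \o L2fun u)).
Proof. by []. Qed.

Lemma L2norm_sqr u : `|u| ^+ 2 = L2dot u u.
Proof.
have NE := finite_norm_fine (Lfun_Sub (lee1n 2) (L2fun_Lfun u)).
rewrite /L2dot /Rintegral L2normE.
rewrite (eq_integral (fun x => `|(EFin \o L2fun u) x| `^ 2)%E); last first.
  by move=> x _; rewrite /= powR_mulrn// real_normK ?num_real.
rewrite -poweR_Lnorm// -NE/= powR_mulrn//.
by rewrite fine_ge0// Lnorm_ge0.
Qed.

Definition L2le u v : Prop := {ae mu, forall x, L2fun u x <= L2fun v x}.

Lemma Lfun2_abs u : (fun x => `|L2fun u x|) \in Lfun mu 2%:E.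
Proof. exact/Lfun2_norm/L2fun_Lfun. Qed.

Let le_normD (a b : R) : Num.max `|a| `|b| <= `| `|a| + `|b| |.
Proof.
rewrite [leRHS]ger0_norm ?addr_ge0// ge_max lerDl normr_ge0/=.
by rewrite lerDr normr_ge0.
Qed.

Let Lfun2_absD u v : (fun x => `|L2fun u x| + `|L2fun v x|) \in Lfun mu 2%:E.
Proof. by apply: Lfun2D; exact: Lfun2_abs. Qed.

Lemma Lfun2_min u v :
  (fun x => Num.min (L2fun u x) (L2fun v x)) \in Lfun mu 2%:E.
Proof.
apply: Lfun2_le (Lfun2_absD u v) _.
  by apply: measurable_minr; exact: L2fun_measurable.
apply: aeW => x /=; apply: le_trans (le_normD _ _).
by case: (leP (L2fun u x)) => _; rewrite le_max lexx ?orbT.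
Qed.

Lemma Lfun2_max u v :
  (fun x => Num.max (L2fun u x) (L2fun v x)) \in Lfun mu 2%:E.
Proof.
apply: Lfun2_le (Lfun2_absD u v) _.
  by apply: measurable_maxr; exact: L2fun_measurable.
apply: aeW => x /=; apply: le_trans (le_normD _ _).
by case: (leP (L2fun u x)) => _; rewrite le_max lexx ?orbT.
Qed.

Lemma Lfun2_mulsg u v :
  (fun x => L2fun u x * Num.sg (L2fun v x)) \in Lfun mu 2%:E.
Proof.
apply: Lfun2_le (L2fun_Lfun u) _.
  apply: measurable_funM; first exact: L2fun_measurable.
  rewrite (_ : (fun x => _) = (fun x => if 0 < L2fun v x then 1 else
      if L2fun v x < 0 then -1 else 0)); last first.
    by apply/funext => x; case: sgrP.
  by apply: measurable_fun_ifT => //;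
    [|apply: measurable_fun_ifT => //];
    apply: measurable_fun_ltr => //; exact: L2fun_measurable.
apply: aeW => x /=; rewrite normrM normr_sg.
by case: eqP => _; rewrite ?mulr0 ?mulr1.
Qed.

Definition L2abs u : L2 := mkL2 (Lfun2_abs u).
Definition L2min u v : L2 := mkL2 (Lfun2_min u v).
Definition L2max u v : L2 := mkL2 (Lfun2_max u v).
(* [u * sign v], with [sign 0 = 0] *)
Definition L2mulsg u v : L2 := mkL2 (Lfun2_mulsg u v).

End L2.

Section ConvexAnalysis.
Context (R : realType) (V : tvsType R).
Implicit Type phi : V -> \bar R.

(* [V -> R U {+oo}] is encoded as [V -> \bar R] together with [no_ninfty]. *)
Definition no_ninfty phi : Prop := forall v, (-oo < phi v)%E.

Definition effdom phi : set V := [set v | (phi v < +oo)%E].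

Definition eproper phi : Prop := effdom phi !=set0.

Definition lsc phi : Prop := forall c : R, closed [set v | (phi v <= c%:E)%E].

Definition econvex phi : Prop := forall (t : R) (v w : V), 0 <= t <= 1 ->
  (phi (t *: v + (1 - t) *: w)%R <= t%:E * phi v + (1 - t)%:E * phi w)%E.

Definition topdual : Type := {l : {linear V -> R^o} | continuous l}.

Definition weak : Type :=
  initial_topology ((fun v l => sval l v) : V -> {ptws topdual -> R^o}).

HB.instance Definition _ := Topological.copy weak
  (initial_topology ((fun v l => sval l v) : V -> {ptws topdual -> R^o})).

Definition rel_weakly_compact (A : set V) : Prop :=
  compact (closure (A : set weak)).

Definition coercive phi : Prop :=
  forall c : R, rel_weakly_compact [set v | (phi v <= c%:E)%E].

End ConvexAnalysis.

Definition weak_continuous (R : realType) (V W : tvsType R) (j : V -> W) : Prop :=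
  continuous (j : weak V -> weak W).

Section Evolution.
Context d (T : measurableType d) (R : realType).
Variable mu : {measure set T -> \bar R}.
Local Notation H := (L2 mu).

Section jSubgradient.
Variables (V : tvsType R) (phi : V -> \bar R) (j : V -> H).

Definition j_elliptic : Prop := exists2 omega : R, 0 <= omega &
  let phi_omega v := (phi v + (omega / 2 * `|j v| ^+ 2)%:E)%E in
  econvex phi_omega /\ coercive phi_omega.

Definition jsubgradient : set (H * H) := [set uf | exists uh : V,
  [/\ effdom phi uh, j uh = uf.1 &
    forall vh : V, ((L2dot uf.2 (j vh))%:E <=
      limf_einf (fun t : R => (phi (uh + t *: vh)%R - phi uh) * (t^-1)%:E)
                0^'+)%E]].
End jSubgradient.

Definition subgradient (psi : H -> \bar R) : set (H * H) := jsubgradient psi id.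

Definition functional_on_H (V : tvsType R) (phi : V -> \bar R) (j : V -> H)
    (phiH : H -> \bar R) : Prop :=
  [/\ no_ninfty phiH, econvex phiH, eproper phiH, lsc phiH &
      jsubgradient phi j `<=` subgradient phiH].

(* The test functions are the C^1 ones: by regularization they define the same
   distributional derivative as the smooth ones. *)
Definition test_function (theta : R -> R) : Prop :=
  [/\ forall t, derivable theta t 1, continuous (derive1 theta) &
      exists a b : R, 0 < a /\ forall t, t \notin `[a, b] -> theta t = 0].

Definition simple_fun (g : R -> H) : Prop :=
  finite_set (range g) /\
  forall h : H, measurable (g @^-1` [set h] : set (measurableTypeR R)).

Definition strongly_measurable (g : R -> H) : Prop :=
  exists s : nat -> R -> H, (forall n, simple_fun (s n)) /\
    forall t, 0 < t -> s n t @[n --> \oo] --> g t.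

Definition locally_ess_bounded (g : R -> H) : Prop :=
  forall a b : R, 0 < a -> exists M : R,
    {ae lebesgue_measure, forall t, a <= t <= b -> `|g t| <= M}.

(* [g] is the distributional derivative of [u] on (0, +oo); the Bochner
   integrals of the definition are tested against every vector of [H]. *)
Definition weak_derivative (u g : R -> H) : Prop :=
  forall (theta : R -> R) (h : H), test_function theta ->
    \int[lebesgue_measure]_(t in `]0, +oo[) (L2dot (u t) h * derive1 theta t) =
    - \int[lebesgue_measure]_(t in `]0, +oo[) (L2dot (g t) h * theta t).

Definition solution (V : tvsType R) (phi : V -> \bar R) (j : V -> H)
    (u0 : H) (u : R -> H) : Prop :=
  [/\ {within `[0, +oo[, continuous u}, u 0 = u0 &
    exists g : R -> H, [/\ strongly_measurable g, locally_ess_bounded g,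
      weak_derivative u g &
      {ae lebesgue_measure, forall t, 0 < t ->
         jsubgradient phi j (u t, - g t)}]].

(* Only the values [S t u0] with [0 <= t] are meaningful. *)
Definition semigroup_generated_by (V : tvsType R) (phi : V -> \bar R)
    (j : V -> H) (S : R -> H -> H) : Prop :=
  forall u0 : H, closure (j @` effdom phi) u0 -> solution phi j u0 (S^~ u0).

Definition positive_cone : set H := [set u | L2le 0 u].

Definition positive_semigroup (S : R -> H -> H) : Prop :=
  forall (t : R) (u : H), 0 <= t -> L2le 0 u -> L2le 0 (S t u).

Definition order_preserving_on (C : set H) (S : R -> H -> H) : Prop :=
  forall (t : R) (u v : H), 0 <= t -> C u -> C v -> L2le u v ->
    L2le (S t u) (S t v).

Definition semigroup_dominated (S1 S2 : R -> H -> H) : Prop :=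
  positive_semigroup S2 /\
  forall (t : R) (u : H), 0 <= t -> L2le (L2abs (S1 t u)) (S2 t (L2abs u)).

End Evolution.

Arguments positive_cone {d T R} mu.

(* Main.v *)
From HB Require Import structures.
Require Import Defs.
From mathcomp Require Import all_boot all_order all_algebra.
From mathcomp Require Import all_classical all_reals all_analysis.
From mathcomp Require Import ring lra measurable_realfun.

Import Order.TTheory GRing.Theory Num.Theory.
Import numFieldNormedType.Exports.

Local Open Scope classical_set_scope.
Local Open Scope ring_scope.

Set Implicit Arguments.
Unset Strict Implicit.
Unset Printing Implicit Defensive.

(** Write [psi_i] for the functional on [H = L^2] attached to [phi_i], and call
    swap of a pair [(u1, u2)] with [u2 >= 0] the pair [(w1, w2)] where
    [w1 = (|u1| /\ u2) sign u1] and [w2 = |u1| \/ u2].  With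
    [a = (|u1| - u2)^+], [w1 = u1 - a sign u1] and [w2 = u2 + a]: the swap is the
    reflection of [(u1, u2)] through its projection onto the closed convex set
    [C] of the pairs with [|y1| <= y2].  Since [S_2] preserves order on the
    positive cone, domination means that [(S_1, S_2)] leaves [C] invariant.

    Assertion 2 implies 1.  Along [(S_1 u, S_2 |u|)] the energy [|a|^2 / 2] has
    the gradient [(a sign u1, - a)], which is the displacement [u - w].  As the
    velocity is minus a subgradient of [psi_1 + psi_2], the derivative of the
    energy is at most [psi w - psi u <= 0].  The energy vanishes at time 0, hence
    always ([swap_dominated]).  Velocities exist only as weak derivatives;
    [energy_increment_le] replaces the chain rule.

    Assertion 1 implies 2.  If [p] in [C] is the projection of [x] onto [C],
    then [psi p <= psi x]: otherwise [|S p - x|] would decrease strictly near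
    time 0, although [S p] stays in [C] ([obtuse_angle_decreases]).  Put
    [f s = psi_1 (u1 - s a sign u1)] and [k s = psi_2 (u2 + (1 - s) a)].
    Projecting the pair with parameters [s - t] and [s + t] yields
    [f s + k s <= f (s - t) + k (s + t)] ([segment_swap]).  In the form
    [f s - f (s - t) <= k (s + t) - k s] these inequalities telescope to
    [f 1 + k 0 <= f 0 + k 1], which is assertion 2; the end points are reached
    by lower semicontinuity ([dyadic_swap], [dominated_swap]).

    Assertions 2 and 3 are equivalent because [psi_i] is, up to a constant, the
    minimum of [phi_i] over the fibers of [j_i] ([functional_on_H_fiber_min]).
    By ellipticity and weak compactness the penalized functional
    [phi v + kappa / 2 |j v - f|^2] has a minimizer for large [kappa], which
    gives a resolvent of the [j]-subgradient.  Two functionals that have this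
    subgradient in common differ by a constant along resolvents, and letting
    [kappa] tend to infinity reaches every point of [H] and, by compactness
    again, a minimizer in its fiber.  Sublevel sets are weakly closed by
    Hahn-Banach. *)

(** * Hahn-Banach theorem *)

Section HahnBanach.
Context (R : realType) (V : lmodType R).
Implicit Types (p q : V -> R) (x y : V).

Definition sublinear p := (forall x y, p (x + y) <= p x + p y) /\
  (forall (t : R) x, 0 < t -> p (t *: x) = t * p x).

Lemma sublinear0 p : sublinear p -> p 0 = 0.
Proof.
move=> [_ ph]; have := ph 2 0 ltac:(lra); rewrite scaler0; lra.
Qed.

Lemma sublinearN p x : sublinear p -> - p (- x) <= p x.
Proof.
by move=> sp; have := sp.1 x (- x); rewrite subrr sublinear0//; lra.
Qed.

Lemma inf_le_of_lbound (E : set R) (m z : R) : lbound E m -> E z -> inf E <= z.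
Proof. by move=> Em Ez; apply: ge_inf => //; exists m. Qed.

(** A sublinear functional below [p], against which minimality is tested. *)
Definition ray_inf p y x := inf [set p (x + t *: y) - t * p y | t in [set t | 0 <= t]].

Lemma ray_inf_lb p y x : sublinear p ->
  lbound [set p (x + t *: y) - t * p y | t in [set t | 0 <= t]] (- p (- x)).
Proof.
move=> sp z [t/= t0] <-.
have pt : p (t *: y) = t * p y.
  move: t0; rewrite le_eqVlt => /predU1P[<-|/sp.2//].
  by rewrite scale0r mul0r sublinear0.
have := sp.1 (x + t *: y) (- x); rewrite addrAC subrr add0r; lra.
Qed.

Lemma ray_inf_le p y x t : sublinear p -> 0 <= t ->
  ray_inf p y x <= p (x + t *: y) - t * p y.
Proof.
by move=> sp t0; apply: (inf_le_of_lbound (ray_inf_lb sp)); exists t.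
Qed.

Lemma ray_inf_ge p y x m :
  (forall t, 0 <= t -> m <= p (x + t *: y) - t * p y) -> m <= ray_inf p y x.
Proof.
move=> h; rewrite /ray_inf; apply: lb_le_inf; last by move=> _ [t/= t0] <-; exact: h.
by exists (p (x + 0 *: y) - 0 * p y); exists 0 => /=.
Qed.

Lemma ray_inf_sublinear p y : sublinear p -> sublinear (ray_inf p y).
Proof.
move=> sp; split=> [x z|t x t0].
- rewrite -lerBlDr.
 apply: ray_inf_ge => t t0.
  rewrite lerBlDr -lerBlDl; apply: ray_inf_ge => s s0.
  rewrite lerBlDl; apply: (le_trans (ray_inf_le y _ (t := s + t) sp _)); first lra.
  have := sp.1 (x + t *: y) (z + s *: y).
  rewrite addrACA -scalerDl (addrC t s); lra.
- apply/eqP; rewrite eq_le; apply/andP; split.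
  + rewrite -ler_pdivrMl//; apply: ray_inf_ge => s s0; rewrite ler_pdivrMl//.
    apply: (le_trans (ray_inf_le y _ (t := t * s) sp _)); first by rewrite mulr_ge0// ltW.
    by rewrite -scalerA -scalerDr sp.2// mulrBr mulrA.
  + apply: ray_inf_ge => s s0; rewrite -ler_pdivlMl// mulrBr.
    have -> : s *: y = t *: ((t^-1 * s) *: y).
      by rewrite scalerA mulrA divff ?mul1r// gt_eqF.
    rewrite -scalerDr sp.2// !mulrA mulVf ?gt_eqF// mul1r.
    by apply: ray_inf_le => //; rewrite mulr_ge0// invr_ge0 ltW.
Qed.

Lemma ray_inf_le_id p y x : sublinear p -> ray_inf p y x <= p x.
Proof.
move=> sp; apply: (le_trans (ray_inf_le y x (t := 0) sp _)) => //.
by rewrite scale0r addr0 mul0r subr0.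
Qed.

(** Zorn's lemma applies because a chain is bounded below by its pointwise
    infimum. *)
Lemma exists_minimal_sublinear p : sublinear p -> exists q,
  [/\ sublinear q, forall x, q x <= p x &
      forall r, sublinear r -> (forall x, r x <= q x) -> r = q].
Proof.
move=> sp; pose T := {q | sublinear q /\ forall x, q x <= p x}.
pose rle (q r : T) : bool := `[< forall x, sval r x <= sval q x >].
have [||||q qmin] := @Zorn T rle.
- by move=> q; apply/asboolP.
- by move=> q r s /asboolP qr /asboolP rs; apply/asboolP => x; exact: le_trans (qr x).
- move=> [q hq] [r hr] /asboolP /= qr /asboolP /= rq.
  by apply: eq_exist; apply/funext => x; apply/le_anti; rewrite qr rq.
- move=> A totA; have [[q0 Aq0]|A0] := pselect (exists q : T, A q); last first.
    by exists (exist _ p (conj sp (fun x => lexx _))) => s As; case: A0; exists s.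
  pose m x := inf [set sval q x | q in A].
  have lbm x : lbound [set sval q x | q in A] (- p (- x)).
    move=> _ [[q [sq qp]] /= _ <-]; have := sublinearN x sq; have := qp (- x); lra.
  have mle (q : T) x : A q -> m x <= sval q x.
    by move=> Aq; apply: (inf_le_of_lbound (lbm x)); exists q.
  have mge x z : (forall q : T, A q -> z <= sval q x) -> z <= m x.
    move=> h; rewrite /m; apply: lb_le_inf; last by move=> _ [q Aq] <-; exact: h.
    by exists (sval q0 x); exists q0.
  have sm : sublinear m.
    split=> [x y|t x t0].
      rewrite -lerBlDr; apply: (mge _ _) => q Aq; rewrite lerBlDr -lerBlDl.
      apply: (mge _ _) => r Ar; rewrite lerBlDl.
      have [/asboolP qr|/asboolP rq] := totA _ _ Aq Ar.
      - have := (svalP r).1.1 x y; have := mle _ (x + y) Ar; have := qr x; lra.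
      - have := (svalP q).1.1 x y; have := mle _ (x + y) Aq; have := rq y; lra.
    apply/eqP; rewrite eq_le; apply/andP; split.
      rewrite -ler_pdivrMl//; apply: (mge _ _) => q Aq; rewrite ler_pdivrMl//.
      by rewrite -(svalP q).1.2//; exact: mle.
    apply: (mge _ _) => q Aq; rewrite (svalP q).1.2// ler_pM2l//; exact: mle.
  have mp x : m x <= p x.
    by apply: le_trans (mle _ x Aq0) _; exact: (svalP q0).2.
  by exists (exist _ m (conj sm mp)) => s As; apply/asboolP => x /=; exact: mle.
- exists (sval q); split; [exact: (svalP q).1|exact: (svalP q).2|].
  move=> r sr rq.
  have rp x : r x <= p x by apply: le_trans (rq x) _; exact: (svalP q).2.
  have := qmin (exist _ r (conj sr rp)).
  by move=> /(_ _)/(congr1 sval) /= ->//; apply/asboolP.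
Qed.

(** By minimality the infimum along the ray of [y] is [q] itself, and its value
    at parameter 1 bounds [q x + q y] by [q (x + y)]. *)
Lemma minimal_sublinear_additive q : sublinear q ->
  (forall r, sublinear r -> (forall x, r x <= q x) -> r = q) ->
  forall x y, q (x + y) = q x + q y.
Proof.
move=> sq qmin x y; apply/eqP; rewrite eq_le sq.1/=.
have := ray_inf_le y x sq ler01.
rewrite (qmin (ray_inf q y)) ?scale1r; first by lra.
- exact: ray_inf_sublinear.
- by move=> z; exact: ray_inf_le_id.
Qed.

(** Minimizing below the infimum of [p] along the ray of [x0], rather than below
    [p], forces the value at [- x0] down to [- p x0]. *)
Lemma hahn_banach_sublinear p x0 : sublinear p -> exists l : {linear V -> R^o},
  (forall x, l x <= p x) /\ p x0 <= l x0.
Proof.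
move=> sp.
have [q [sq qp qmin]] := exists_minimal_sublinear (ray_inf_sublinear x0 sp).
have qD := minimal_sublinear_additive sq qmin.
have q0 := sublinear0 sq.
have qN x : q (- x) = - q x by have := qD x (- x); rewrite subrr q0; lra.
have qZ (a : R) x : q (a *: x) = a * q x.
  have [a0|a0|<-] := ltgtP 0 a; first exact: sq.2.
  - have -> : a *: x = - ((- a) *: x) by rewrite scaleNr opprK.
    by rewrite qN sq.2 ?oppr_gt0// mulNr opprK.
  - by rewrite scale0r mul0r.
have ql : linear (q : V -> R^o) by move=> a x y; rewrite qD qZ.
pose l : {linear V -> R^o} := HB.pack (q : V -> R^o)
  (GRing.isLinear.Build R V R^o *:%R q ql).
exists l; split=> [x|]; rewrite /l/=.
  by apply: le_trans (qp x) _; exact: ray_inf_le_id.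
have := qp (- x0); have := ray_inf_le x0 (- x0) sp ler01.
by rewrite qN scale1r addNr sublinear0//; lra.
Qed.

End HahnBanach.

(** * Weak closedness of closed convex sets *)

Section Gauge.
Context (R : realType) (V : lmodType R).

(** The notion [convex_set], stated with real weights rather than with its type of
    barycentric coefficients. *)
Definition is_convex (A : set V) := forall (t : R) x y,
  0 <= t <= 1 -> A x -> A y -> A (t *: x + (1 - t) *: y).

Definition gauge (K : set V) x : R := inf [set s | 0 < s /\ K (s^-1 *: x)].

Variable K : set V.
Hypothesis K_convex : is_convex K.
Hypothesis K_absorbing : forall x, exists2 t : R, 0 < t & K (t *: x).

Lemma gauge_le x s : 0 < s -> K (s^-1 *: x) -> gauge K x <= s.
Proof. by move=> s0 Ks; apply: (@inf_le_of_lbound _ _ 0) => // t [/ltW]. Qed.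

Lemma gauge_ge x m : (forall s, 0 < s -> K (s^-1 *: x) -> m <= s) ->
  m <= gauge K x.
Proof.
move=> h; apply: lb_le_inf => [|s [s0 Ks]]; last exact: h.
have [t t0 Kt] := K_absorbing x; exists t^-1.
by split; rewrite ?invr_gt0 ?invrK.
Qed.

Lemma gauge_sublinear : sublinear (gauge K).
Proof.
split=> [x y|t x t0].
- rewrite -lerBlDr; apply: gauge_ge => s s0 Ks; rewrite lerBlDr -lerBlDl.
  apply: gauge_ge => t t0 Kt; rewrite lerBlDl; apply: gauge_le; first lra.
  have st0 : s + t != 0 by lra.
  have -> : (s + t)^-1 *: (x + y) =
      (s / (s + t)) *: (s^-1 *: x) + (1 - s / (s + t)) *: (t^-1 *: y).
    rewrite scalerDr !scalerA; congr (_ *: _ + _ *: _).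
      by field; rewrite st0/=; lra.
    by field; rewrite st0/=; lra.
  apply: K_convex => //; apply/andP; split; first by rewrite divr_ge0//; lra.
  by rewrite ler_pdivrMr; lra.
- have le_gauge (a : R) y : 0 < a -> gauge K (a *: y) <= a * gauge K y.
    move=> a0; rewrite -ler_pdivrMl//; apply: gauge_ge => s s0 Ks.
    rewrite ler_pdivrMl//; apply: gauge_le; first exact: mulr_gt0.
    by rewrite scalerA (_ : (a * s)^-1 * a = s^-1)//; field; lra.
  apply/eqP; rewrite eq_le le_gauge//= -ler_pdivlMl//.
  have := le_gauge t^-1 (t *: x) ltac:(by rewrite invr_gt0).
  by rewrite scalerA mulVf ?scale1r// gt_eqF.
Qed.

Lemma gauge_le1 x : K x -> gauge K x <= 1.
Proof. by move=> Kx; apply: gauge_le; rewrite ?invr1 ?scale1r. Qed.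

Lemma gauge_ge1 x : K 0 -> ~ K x -> 1 <= gauge K x.
Proof.
move=> K0 Kx; apply: gauge_ge => s s0 Ks; rewrite leNgt; apply/negP => s1.
apply: Kx; have := K_convex (t := s) ltac:(by lra) Ks K0.
by rewrite scaler0 addr0 scalerA divff ?scale1r// gt_eqF.
Qed.

End Gauge.

Section Separation.
Context (R : realType) (V : tvsType R).
Implicit Types (x y : V) (C : set V).

Lemma line_continuous x y : continuous (fun t : R => x + t *: y).
Proof.
move=> t; apply: (@continuous_comp R (V * V)%type V (fun t : R => (x, t *: y))
  (fun z : V * V => z.1 + z.2)); last exact: add_continuous.
apply: cvg_pair => /=; first exact: cvg_cst.
apply: (@continuous_comp R (R^o * V)%type V (fun t : R => (t : R^o, y))
  (fun z : R^o * V => z.1 *: z.2)); last exact: scale_continuous.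
by apply: (@cvg_pair R R^o V (nbhs t) (nbhs (t : R^o)) (nbhs y)); [exact: cvg_id|exact: cvg_cst].
Qed.

Lemma affine_continuous (a : R) x : continuous (fun y : V => x + a *: y).
Proof.
move=> y; apply: (@continuous_comp V (V * V)%type V (fun y : V => (x, a *: y))
  (fun z : V * V => z.1 + z.2)); last exact: add_continuous.
apply: cvg_pair => /=; first exact: cvg_cst.
apply: (@continuous_comp V (R^o * V)%type V (fun y : V => (a : R^o, y))
  (fun z : R^o * V => z.1 *: z.2)); last exact: scale_continuous.
by apply: (@cvg_pair V R^o V (nbhs y) (nbhs (a : R^o)) (nbhs y)); [exact: cvg_cst|exact: cvg_id].
Qed.

Lemma nbhs_line x y (B : set V) : nbhs x B -> exists2 t : R, 0 < t & B (x + t *: y).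
Proof.
move=> Bx; have := @line_continuous x y 0 B; rewrite /= scale0r addr0.
move=> /(_ Bx)/nbhs_ballP[e/= e0 /(_ (e / 2))].
rewrite /ball/= sub0r normrN gtr0_norm; last lra.
by move=> h; exists (e / 2); [lra|apply: h; lra].
Qed.

Lemma linear_bounded_nbhs_continuous (l : {linear V -> R^o}) (W : set V) :
  nbhs 0 W -> (forall v, W v -> `|l v| <= 1) -> continuous l.
Proof.
move=> W0 lW y; apply/(@cvgrPdist_le _ R^o) => e e0.
have := @affine_continuous e^-1 (- (e^-1 *: y)) y W.
rewrite /= addNr => /(_ W0) Wy; apply: (@filterS _ (nbhs (y : V)) _ _ _ _ Wy) => z /= /lW.
rewrite -scalerN -scalerDr linearZ/= addrC linearB/= normrM gtr0_norm ?invr_gt0//.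
by rewrite ler_pdivrMl// mulr1 distrC.
Qed.

Lemma convex_nbhs x (U : set V) : nbhs x U ->
  exists B : set V, [/\ open B, B x, B `<=` U & is_convex B].
Proof.
move=> Ux; have [B Bc [Bo Bb]] := @locally_convex R V.
have [b [Bb' bx] bU] := Bb x U Ux; exists b; split => //; first exact: Bo.
move=> t y z; rewrite le_eqVlt => /andP[/predU1P[<- _ _ bz|t0]].
  by rewrite scale0r add0r subr0 scale1r.
rewrite le_eqVlt => /predU1P[-> //|t1 by_ bz].
  by rewrite subrr scale0r addr0 scale1r.
have t01 : Itv.spec (Itv.num_sem (R:=R)) (Itv.Real `[0%Z, 1%Z]) t.
  by rewrite /= /Itv.num_sem /= realE !in_itv/= (ltW t0) (ltW t1).
have := Bc b (mem_set Bb') y z (Itv.mk t01) (mem_set by_) (mem_set bz).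
by rewrite inE.
Qed.

(** Hahn-Banach applied to the gauge of [C - B], where [B] is a convex
    neighbourhood of [x0] missing [C]. *)
Lemma closed_convex_separation C x0 : closed C -> is_convex C -> ~ C x0 ->
  exists (l : topdual V) (m : R), (forall c, C c -> sval l c <= m) /\ m < sval l x0.
Proof.
move=> clC coC Cx0.
have [[c0 Cc0]|C0] := pselect (exists c, C c); last first.
  have c0 : continuous (\0 : {linear V -> R^o}) by move=> x; exact: cvg_cst.
  exists (exist _ (\0 : {linear V -> R^o}) c0), (- 1); split=> /=; last lra.
  by move=> c Cc; case: C0; exists c.
have [B [oB Bx0 BC coB]] : exists B : set V,
    [/\ open B, B x0, B `<=` ~` C & is_convex B].
  by apply: convex_nbhs; apply: open_nbhs_nbhs; split => //; exact: closed_openC.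
have nB : nbhs x0 B by exact: open_nbhs_nbhs.
(* Translating by [z0] puts 0 in [C - B + z0], while [z0] is outside since [B]
   misses [C]. *)
pose z0 := x0 - c0.
pose K := [set v | exists c b, [/\ C c, B b & v = c - b + z0]].
have KB v : B (x0 - v) -> K v.
  move=> Bv; exists c0, (x0 - v); split => //.
  by rewrite /z0 opprB [c0 + _]addrA addrA subrK addrAC subrr add0r.
have K_convex : is_convex K.
  move=> t _ _ t01 [c [b [Cc Bb ->]]] [c' [b' [Cc' Bb' ->]]].
  exists (t *: c + (1 - t) *: c'), (t *: b + (1 - t) *: b').
  split; [exact: coC|exact: coB|].
  have comb (z : V) : t *: (c - b + z) + (1 - t) *: (c' - b' + z) =
      (t *: c + (1 - t) *: c') - (t *: b + (1 - t) *: b') + z.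
    rewrite !scalerDr addrACA -scalerDl [t + _]addrC subrK scale1r.
    by rewrite !scalerN addrACA opprD.
  exact: comb.
have K_absorbing v : exists2 t : R, 0 < t & K (t *: v).
  have [t t0 Bt] := nbhs_line (- v) nB; exists t => //.
  by apply: KB; rewrite -scalerN.
have K0 : K 0 by apply: KB; rewrite subr0.
have Kz0 : ~ K z0.
  move=> [c [b [Cc Bb]]] /eqP; rewrite eq_sym -subr_eq0 addrK subr_eq0 => /eqP cb.
  by apply: (BC b) => //; rewrite -cb.
have [l [lK lz0]] := hahn_banach_sublinear z0 (gauge_sublinear K_convex K_absorbing).
have {}lz0 : 1 <= l z0 by apply: le_trans lz0; exact: gauge_ge1.
have {}lK v : K v -> l v <= 1.
  by move=> Kv; apply: le_trans (lK v) _; exact: gauge_le1.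
have cl : continuous l.
  apply: (@linear_bounded_nbhs_continuous l
    ((fun v => x0 + (-1) *: v) @^-1` B `&` (fun v => x0 + 1 *: v) @^-1` B)).
    by apply: filterI; apply: affine_continuous; rewrite scaler0 addr0.
  move=> v [/= B1 B2]; rewrite ler_norml; apply/andP; split; last first.
    by apply/lK/KB; rewrite -scaleN1r.
  rewrite lerNl -linearN; apply/lK/KB; rewrite opprK.
  by move: B2; rewrite scale1r.
have [t t0 Bt] := nbhs_line (- z0) nB.
exists (exist _ l cl), (l x0 - t * l z0); split => /=; last first.
  by rewrite ltrBlDr ltrDl mulr_gt0//; lra.
move=> c Cc; have : l (c - (x0 + t *: - z0) + z0) <= 1.
  by apply: lK; exists c, (x0 + t *: - z0).
have lZ (a : R) v : l (a *: v) = a * l v by rewrite linearZ.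
rewrite linearD linearB [in l (_ + _)]linearD lZ linearN.
by lra.
Qed.

Lemma weak_topdual_continuous (l : topdual V) :
  continuous (sval l : weak V -> R^o).
Proof.
move=> v; pose ev (v : V) := (fun l => sval l v) : {ptws topdual V -> R^o}.
have evc : ev x @[x --> (v : weak V)] --> ev v.
  exact: (@initial_continuous V {ptws topdual V -> R^o} ev v).
have Fv : Filter (ev x @[x --> (v : weak V)]).
  exact: (@fmap_filter _ _ _ _ (nbhs_filter (v : weak V))).
move/cvg_sup : evc => /(_ l) h Q Qv.
exact: (h _ (@initial_continuous {ptws topdual V -> R^o} R^o (fun f => f l) (ev v) Q Qv)).
Qed.

Theorem closed_convex_weakly_closed C : closed C -> is_convex C ->
  closed (C : set (weak V)).
Proof.
move=> clC coC x0 /= cx; apply: contrapT => Cx0.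
have [l [m [Cm mx0]]] := closed_convex_separation clC coC Cx0.
have := @weak_topdual_continuous l x0 [set r | m < r].
rewrite /= => /(_ _) h; have /cx[c [Cc /=]] := h ltac:(exact: lt_nbhsr).
by rewrite ltNge Cm.
Qed.

End Separation.

(** * Inner product of $L^2$ *)

Section AeRintegral.
Context d (T : measurableType d) (R : realType) (mu : {measure set T -> \bar R}).
Variables (D : set T) (mD : measurable D).

Lemma ae_eq_Rintegral (f g : T -> R) :
  mu.-integrable D (EFin \o f) -> mu.-integrable D (EFin \o g) ->
  {ae mu, forall x, D x -> f x = g x} ->
  \int[mu]_(x in D) f x = \int[mu]_(x in D) g x.
Proof.
move=> fi gi fg; congr fine; apply: ae_eq_integral => //.
- exact: measurable_int fi.
- exact: measurable_int gi.
- by apply: filterS fg => x /= + Dx => ->.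
Qed.

Lemma ae_Rintegral_ge0 (f : T -> R) : mu.-integrable D (EFin \o f) ->
  {ae mu, forall x, D x -> 0 <= f x} -> 0 <= \int[mu]_(x in D) f x.
Proof.
move=> fi f0; rewrite (@ae_eq_Rintegral f (fun x => `|f x|))//.
- by apply: Rintegral_ge0.
- by have := integrable_abse fi; apply: eq_integrable.
- by apply: filterS f0 => x /= f0 /f0 {}f0; rewrite ger0_norm.
Qed.

Lemma ae_le_Rintegral (f g : T -> R) :
  mu.-integrable D (EFin \o f) -> mu.-integrable D (EFin \o g) ->
  {ae mu, forall x, D x -> f x <= g x} ->
  \int[mu]_(x in D) f x <= \int[mu]_(x in D) g x.
Proof.
move=> fi gi fg; rewrite -subr_ge0 -RintegralB//; apply: ae_Rintegral_ge0.
  by have := integrableB mD gi fi; apply: eq_integrable.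
by apply: filterS fg => x /= fg /fg; rewrite subr_ge0.
Qed.

End AeRintegral.

Section L2InnerProduct.
Context d (T : measurableType d) (R : realType) (mu : {measure set T -> \bar R}).
Local Notation H := (L2 mu).
Implicit Types u v w : H.

Lemma L2funD u v :
  {ae mu, forall x, L2fun (u + v) x = L2fun u x + L2fun v x}.
Proof. exact: L2addE. Qed.

Lemma L2funZ (a : R) u : {ae mu, forall x, L2fun (a *: u) x = a * L2fun u x}.
Proof. exact: L2scaleE. Qed.

Lemma L2funN u : {ae mu, forall x, L2fun (- u) x = - L2fun u x}.
Proof. by rewrite -scaleN1r; apply: filterS (L2funZ (-1) u) => x ->; rewrite mulN1r. Qed.

Lemma L2funB u v :
  {ae mu, forall x, L2fun (u - v) x = L2fun u x - L2fun v x}.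
Proof. by apply: filterS2 (L2funD u (- v)) (L2funN v) => x -> ->. Qed.

Lemma L2fun0 : {ae mu, forall x, L2fun (0 : H) x = 0}.
Proof. exact: L2zeroE. Qed.

Lemma L2dot_integrable u v :
  mu.-integrable setT (EFin \o (fun x => L2fun u x * L2fun v x)).
Proof.
apply/Lfun1_integrable; exact: (Lfun2_mul_Lfun1 (L2fun_Lfun u) (L2fun_Lfun v)).
Qed.

Lemma L2dotC u v : L2dot u v = L2dot v u.
Proof. by apply: eq_Rintegral => x _; rewrite mulrC. Qed.

Lemma L2dotDl u v w : L2dot (u + v) w = L2dot u w + L2dot v w.
Proof.
rewrite /L2dot -RintegralD//; [|exact: L2dot_integrable..].
apply: ae_eq_Rintegral => //; first exact: L2dot_integrable.
- have := integrableD measurableT (L2dot_integrable u w) (L2dot_integrable v w).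
  by apply: eq_integrable => // x _ /=; rewrite EFinD.
- by apply: filterS (L2funD u v) => x -> _; rewrite mulrDl.
Qed.

Lemma L2dotZl (a : R) u v : L2dot (a *: u) v = a * L2dot u v.
Proof.
rewrite /L2dot -RintegralZl//; last exact: L2dot_integrable.
apply: ae_eq_Rintegral => //; first exact: L2dot_integrable.
- have := integrableZl measurableT a (L2dot_integrable u v).
  by apply: eq_integrable => // x _ /=; rewrite EFinM.
- by apply: filterS (L2funZ a u) => x -> _; rewrite mulrA.
Qed.

Lemma L2dotDr u v w : L2dot u (v + w) = L2dot u v + L2dot u w.
Proof. by rewrite L2dotC L2dotDl !(L2dotC _ u). Qed.

Lemma L2dotZr (a : R) u v : L2dot u (a *: v) = a * L2dot u v.
Proof. by rewrite L2dotC L2dotZl L2dotC. Qed.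

Lemma L2dotNl u v : L2dot (- u) v = - L2dot u v.
Proof. by rewrite -scaleN1r L2dotZl mulN1r. Qed.

Lemma L2dotNr u v : L2dot u (- v) = - L2dot u v.
Proof. by rewrite L2dotC L2dotNl L2dotC. Qed.

Lemma L2dotBl u v w : L2dot (u - v) w = L2dot u w - L2dot v w.
Proof. by rewrite L2dotDl L2dotNl. Qed.

Lemma L2dotBr u v w : L2dot u (v - w) = L2dot u v - L2dot u w.
Proof. by rewrite L2dotDr L2dotNr. Qed.

Lemma L2dot0l u : L2dot 0 u = 0.
Proof. by rewrite -(scale0r (0 : H)) L2dotZl mul0r. Qed.

Lemma L2dot0r u : L2dot u 0 = 0.
Proof. by rewrite L2dotC L2dot0l. Qed.

Definition L2dotE := (L2dotDl, L2dotDr, L2dotBl, L2dotBr, L2dotZl, L2dotZr,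
  L2dotNl, L2dotNr, L2dot0l, L2dot0r).

Lemma L2norm_sqrD u v : `|u + v| ^+ 2 = `|u| ^+ 2 + 2 * L2dot u v + `|v| ^+ 2.
Proof. by rewrite !L2norm_sqr !L2dotE (L2dotC v u); ring. Qed.

Lemma L2norm_sqrB u v : `|u - v| ^+ 2 = `|u| ^+ 2 - 2 * L2dot u v + `|v| ^+ 2.
Proof. by rewrite !L2norm_sqr !L2dotE (L2dotC v u); ring. Qed.

Lemma L2_cauchy_schwarz u v : L2dot u v <= `|u| * `|v|.
Proof.
have [->|u0] := eqVneq u 0; first by rewrite L2dot0l normr0 mul0r.
have [->|v0] := eqVneq v 0; first by rewrite L2dot0r normr0 mulr0.
have nu : 0 < `|u| by rewrite normr_gt0.
have nv : 0 < `|v| by rewrite normr_gt0.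
have := sqr_ge0 (`| `|v| *: u - `|u| *: v|).
rewrite L2norm_sqrB !normrZ !normr_id !L2dotE.
have -> : (`|v| * `|u|) ^+ 2 - 2 * (`|v| * (`|u| * L2dot u v)) +
  (`|u| * `|v|) ^+ 2 = 2 * (`|u| * `|v|) * (`|u| * `|v| - L2dot u v) by ring.
by rewrite pmulr_rge0 ?subr_ge0// !mulr_gt0.
Qed.

Lemma L2dot_sum_ge0 (n : nat) (u v : 'I_n -> H) :
  {ae mu, forall x, 0 <= \sum_(i < n) L2fun (u i) x * L2fun (v i) x} ->
  0 <= \sum_(i < n) L2dot (u i) (v i).
Proof.
move=> h.
have [] : mu.-integrable setT
    (EFin \o (fun x => \sum_(i < n) L2fun (u i) x * L2fun (v i) x)) /\
    \int[mu]_x (\sum_(i < n) L2fun (u i) x * L2fun (v i) x) =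
    \sum_(i < n) L2dot (u i) (v i).
  elim: n u v {h} => [|n ih] u v.
    rewrite big_ord0; split; last by under eq_Rintegral do rewrite big_ord0;
      rewrite Rintegral_cst// mul0r.
    have := integrable0 mu (setT : set T); apply: eq_integrable => // x _ /=.
    by rewrite big_ord0.
  have [ih1 ih2] := ih (u \o widen_ord (leqnSn n)) (v \o widen_ord (leqnSn n)).
  split.
    have := integrableD measurableT ih1 (L2dot_integrable (u ord_max) (v ord_max)).
    by apply: eq_integrable => // x _ /=; rewrite big_ord_recr/= EFinD.
  rewrite big_ord_recr/= -ih2.
  under eq_Rintegral do rewrite big_ord_recr/=.
  by rewrite RintegralD//; exact: L2dot_integrable.
move=> fi <-; apply: ae_Rintegral_ge0 => //.
by apply: filterS h => x + _.
Qed.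

Lemma L2norm_le u v : {ae mu, forall x, `|L2fun u x| <= `|L2fun v x|} ->
  `|u| <= `|v|.
Proof.
move=> uv; rewrite -(@ler_pXn2r _ 2)// ?nnegrE// !L2norm_sqr -subr_ge0.
have := @L2dot_sum_ge0 2 (fun i => if i == 0 then v else - u)
  (fun i => if i == 0 then v else u).
rewrite !big_ord_recl !big_ord0/= addr0 L2dotNl; apply.
apply: filterS2 uv (L2funN u) => x uv uN.
rewrite !big_ord_recl !big_ord0/= addr0 uN mulNr subr_ge0.
have uv2 : `|L2fun u x| ^+ 2 <= `|L2fun v x| ^+ 2 by rewrite ler_pXn2r ?nnegrE.
by move: uv2; rewrite !real_normK ?num_real// !expr2.
Qed.

End L2InnerProduct.

(** * Piecewise quadratic test functions *)

Section SmoothStep.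
Context (R : realType).
Implicit Types (x t a b e : R) (f g : R -> R).

Lemma is_derive_quadratic_error f x l (C : R) :
  (forall h, `|f (x + h) - f x - l * h| <= C * h ^+ 2) -> is_derive x 1 f l.
Proof.
move=> fl.
have cvgl : h^-1 *: (f (h *: 1 + x) - f x) @[h --> 0^'] --> l.
  apply/cvgrPdist_le => e e0; near=> h.
  have h0 : h != 0 by near: h; exact: nbhs_dnbhs_neq.
  have -> : l - h^-1 *: (f (h *: 1 + x) - f x) =
      - (h^-1 * (f (x + h) - f x - l * h)).
    by rewrite /GRing.scale/= mulr1 (addrC h); field.
  rewrite normrN normrM normfV ler_pdivrMl ?normr_gt0//.
  apply: le_trans (fl h) _; rewrite -[h ^+ 2]real_normK ?num_real// expr2 mulrCA ler_wpM2l//.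
  apply: le_trans (_ : (`|C| + 1) * `|h| <= e).
    by rewrite ler_wpM2r// (le_trans (ler_norm _))// lerDl.
  have C0 : 0 < `|C| + 1 by rewrite ltr_wpDl.
  rewrite mulrC -ler_pdivlMr//; near: h; apply: dnbhs0_le.
  by rewrite divr_gt0.
apply: DeriveDef; first by apply/cvg_ex; exists l.
exact: cvg_lim.
Unshelve. all: by end_near. Qed.

Definition pospart x : R := Num.max 0 x.

Lemma pospart_sqr_error x h :
  `|pospart (x + h) ^+ 2 - pospart x ^+ 2 - 2 * pospart x * h| <= h ^+ 2.
Proof.
rewrite ler_norml /pospart; have [] := leP 0 x; have [] := leP 0 (x + h) => xh x0.
all: apply/andP; split; nra.
Qed.

Lemma pospart_continuous a : continuous (fun t => pospart (t - a)).
Proof.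
move=> t; apply: (@continuous_max R R (cst 0) (fun t => t - a)); first exact: cvg_cst.
by apply: cvgB; [exact: cvg_id|exact: cvg_cst].
Qed.

(** A $C^1$ step, equal to 0 up to [a] and to 1 from [a + 2e] on. *)
Definition step a e t : R := (pospart (t - a) ^+ 2 -
  2 * pospart (t - (a + e)) ^+ 2 + pospart (t - (a + 2 * e)) ^+ 2) / (2 * e ^+ 2).

(** The derivative of [step]. *)
Definition hat a e t : R := (pospart (t - a) -
  2 * pospart (t - (a + e)) + pospart (t - (a + 2 * e))) / e ^+ 2.

Lemma hat_continuous a e : continuous (hat a e).
Proof.
move=> t; apply: cvgM; last exact: cvg_cst.
apply: cvgD; last exact: pospart_continuous.
apply: cvgB; first exact: pospart_continuous.
by apply: cvgM; [exact: cvg_cst|exact: pospart_continuous].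
Qed.

Lemma is_derive_step a e t : 0 < e -> is_derive t 1 (step a e) (hat a e t).
Proof.
move=> e0; apply: (is_derive_quadratic_error (C := 2 / e ^+ 2)) => h.
have E1 := pospart_sqr_error (t - a) h.
have E2 := pospart_sqr_error (t - (a + e)) h.
have E3 := pospart_sqr_error (t - (a + 2 * e)) h.
rewrite /step /hat ![t + h - _]addrAC.
move: E1 E2 E3; move: (pospart (t - a)) (pospart (t - a + h)) => p1 q1.
move: (pospart (t - (a + e))) (pospart (t - (a + e) + h)) => p2 q2.
move: (pospart (t - (a + 2 * e))) (pospart (t - (a + 2 * e) + h)) => p3 q3.
move=> E1 E2 E3.
have -> : (q1 ^+ 2 - 2 * q2 ^+ 2 + q3 ^+ 2) / (2 * e ^+ 2) -
   (p1 ^+ 2 - 2 * p2 ^+ 2 + p3 ^+ 2) / (2 * e ^+ 2) -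
   (p1 - 2 * p2 + p3) / e ^+ 2 * h =
   ((q1 ^+ 2 - p1 ^+ 2 - 2 * p1 * h) - 2 * (q2 ^+ 2 - p2 ^+ 2 - 2 * p2 * h)
    + (q3 ^+ 2 - p3 ^+ 2 - 2 * p3 * h)) / (2 * e ^+ 2) by field; lra.
have e20 : 0 < 2 * e ^+ 2 by rewrite mulr_gt0// exprn_gt0.
rewrite normrM normfV (gtr0_norm e20) ler_pdivrMr//.
have -> : 2 / e ^+ 2 * h ^+ 2 * (2 * e ^+ 2) = 4 * h ^+ 2 by field; lra.
by move: E1 E2 E3; rewrite !ler_norml => /andP[? ?] /andP[? ?] /andP[? ?]; lra.
Qed.

Lemma step0 a e t : 0 < e -> t <= a -> step a e t = 0.
Proof.
move=> e0 ta; by rewrite /step /pospart !max_l; lra.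
Qed.

Lemma step1 a e t : 0 < e -> a + 2 * e <= t -> step a e t = 1.
Proof. by move=> e0 ta; rewrite /step /pospart !max_r; try lra; field; lra. Qed.

Lemma step01 a e t : 0 < e -> 0 <= step a e t <= 1.
Proof.
move=> e0; have e20 : 0 < 2 * e ^+ 2 by rewrite mulr_gt0// exprn_gt0.
rewrite /step ler_pdivrMr// mul1r divr_ge0 ?(ltW e20)//= /pospart.
  by have [|] := leP 0 (t - a); have [|] := leP 0 (t - (a + e));
    have [|] := leP 0 (t - (a + 2 * e)) => ? ? ?; nra.
by have [|] := leP 0 (t - a); have [|] := leP 0 (t - (a + e));
    have [|] := leP 0 (t - (a + 2 * e)) => ? ? ?; nra.
Qed.

Lemma hat_ge0 a e t : 0 < e -> 0 <= hat a e t.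
Proof.
move=> e0; rewrite /hat divr_ge0 ?exprn_ge0 ?(ltW e0)// /pospart.
by have [|] := leP 0 (t - a); have [|] := leP 0 (t - (a + e));
    have [|] := leP 0 (t - (a + 2 * e)) => ? ? ?; lra.
Qed.

Lemma hat_out a e t : 0 < e -> t \notin `[a, a + 2 * e] -> hat a e t = 0.
Proof.
move=> e0; rewrite in_itv/= negb_and -!ltNge => /orP[] ta; rewrite /hat /pospart.
  by rewrite !max_l; lra.
by rewrite !max_r; lra.
Qed.

Lemma Rintegral_hat a e : 0 < e ->
  \int[lebesgue_measure]_(t in `[a, a + 2 * e]) hat a e t = 1.
Proof.
move=> e0; rewrite /Rintegral (@continuous_FTC2 _ _ (step a e)).
- by rewrite step1// step0//= subr0.
- lra.
- by apply: continuous_subspaceT; exact: hat_continuous.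
- have sd t : derivable (step a e) t 1 by have [] := is_derive_step a t e0.
  have sc t : {for t, continuous (step a e)}.
    by apply: differentiable_continuous; apply/derivable1_diffP.
  split => [t _||]; [exact: sd|exact: (cvg_at_right_filter (sc _))|exact: (cvg_at_left_filter (sc _))].
- by move=> t _; rewrite derive1E; have [_ ->] := is_derive_step a t e0.
Qed.

Definition plateau a b e t : R := step a e t - step (b - 2 * e) e t.

Lemma is_derive_plateau a b e t : 0 < e ->
  is_derive t 1 (plateau a b e) (hat a e t - hat (b - 2 * e) e t).
Proof. by move=> e0; apply: is_deriveB; exact: is_derive_step. Qed.

Lemma derive1_plateau a b e t : 0 < e ->
  derive1 (plateau a b e) t = hat a e t - hat (b - 2 * e) e t.
Proof. by move=> e0; rewrite derive1E; have [_ ->] := is_derive_plateau a b t e0. Qed.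

Lemma test_function_plateau a b e : 0 < a -> 0 < e -> a + 4 * e <= b ->
  test_function (plateau a b e).
Proof.
move=> a0 e0 ab; split.
- by move=> t; have [] := is_derive_plateau a b t e0.
- rewrite (_ : derive1 _ = fun t => hat a e t - hat (b - 2 * e) e t).
    by move=> t; apply: cvgB; exact: hat_continuous.
  by apply/funext => t; exact: derive1_plateau.
- exists a, b; split=> // t; rewrite in_itv/= negb_and -!ltNge /plateau.
  move=> /orP[] ta; first by rewrite !step0 ?subr0//; lra.
  by rewrite !step1 ?subrr//; lra.
Qed.

Lemma plateau01 a b e t : 0 < e -> a + 4 * e <= b -> 0 <= plateau a b e t <= 1.
Proof.
move=> e0 ab; rewrite /plateau; have [tb|tb] := leP t (b - 2 * e).
  by rewrite [step (b - _) _ _]step0// subr0 step01.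
rewrite step1//; last lra.
by have := step01 (b - 2 * e) t e0; lra.
Qed.

Lemma plateau1 a b e t : 0 < e -> a + 2 * e <= t <= b - 2 * e ->
  plateau a b e t = 1.
Proof. by move=> e0 /andP[at_ tb]; rewrite /plateau step1// step0// subr0. Qed.

End SmoothStep.

(** * Increments of functions with a weak derivative *)

Section AeBounded.
Context d (T : measurableType d) (R : realType) (mu : {measure set T -> \bar R}).

Lemma ae_imply (P Q : T -> Prop) : (forall x, P x -> Q x) ->
  {ae mu, forall x, P x} -> {ae mu, forall x, Q x}.
Proof. by move=> PQ; apply: filterS. Qed.

Lemma ae_imply2 (P Q S : T -> Prop) : (forall x, P x -> Q x -> S x) ->
  {ae mu, forall x, P x} -> {ae mu, forall x, Q x} -> {ae mu, forall x, S x}.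
Proof. by move=> PQ; apply: filterS2. Qed.

Lemma ae_and (P Q : T -> Prop) : {ae mu, forall x, P x} -> {ae mu, forall x, Q x} ->
  {ae mu, forall x, P x /\ Q x}.
Proof. by apply: filterS2. Qed.

Lemma ae_imply3 (P Q S W : T -> Prop) : (forall x, P x -> Q x -> S x -> W x) ->
  {ae mu, forall x, P x} -> {ae mu, forall x, Q x} -> {ae mu, forall x, S x} ->
  {ae mu, forall x, W x}.
Proof. by move=> PQ; apply: filterS3. Qed.

Lemma ae_bounded_integrable (A : set T) (f : T -> R) (M : R) : measurable A ->
  (mu A < +oo)%E -> measurable_fun A f ->
  {ae mu, forall x, A x -> `|f x| <= M} -> mu.-integrable A (EFin \o f).
Proof.
move=> mA Aoo mf fM; apply/integrableP; split; first exact/measurable_EFinP.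
apply: (@le_lt_trans _ _ (\int[mu]_(x in A) (cst `|M|%:E x))%E).
  apply: ae_ge0_le_integral => //.
  - by apply: measurableT_comp => //; exact/measurable_EFinP.
  - by move=> x _; rewrite lee_fin.
  - apply: filterS fM => x /= fM /fM {}fM.
    by rewrite lee_fin (le_trans fM)// ler_norm.
by rewrite integral_cst// lte_mul_pinfty.
Qed.

Lemma Rintegral_support (A D : set T) (f : T -> R) : A `<=` D ->
  (forall x, D x -> ~ A x -> f x = 0) ->
  \int[mu]_(x in D) f x = \int[mu]_(x in A) f x.
Proof.
move=> AD f0; rewrite Rintegral_mkcond [RHS]Rintegral_mkcond.
congr Rintegral; apply/funext => x; rewrite /patch.
case: (boolP (x \in A)) => xA; first by rewrite mem_set//; apply/AD/set_mem.
case: ifPn => // xD; apply: f0; first exact: set_mem.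
by move=> Ax; move: xA; rewrite mem_set.
Qed.

End AeBounded.

Section WeakDerivative.
Context (R : realType).
Implicit Types (m q : R -> R) (a b e c : R).
Local Notation leb := (@lebesgue_measure R).

Lemma integrable_itv m a b : {within `[a, b], continuous m} ->
  leb.-integrable `[a, b] (EFin \o m).
Proof. by move=> cm; apply: continuous_compact_integrable => //; exact: segment_compact. Qed.

Lemma lebesgue_itv_lty a b : (leb `[a, b]%classic < +oo)%E.
Proof. by rewrite lebesgue_measure_itv/=; case: ifP => _; rewrite ltry. Qed.

Lemma hat_average m a e c eps : 0 < e -> {within `[a, a + 2 * e], continuous m} ->
  (forall t, a <= t <= a + 2 * e -> `|m t - c| <= eps) ->
  `|\int[leb]_(t in `[a, a + 2 * e]) (m t * hat a e t) - c| <= eps.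
Proof.
move=> e0 cm mc.
have ch : {within `[a, a + 2 * e], continuous (hat a e)}.
  by apply: continuous_subspaceT; exact: hat_continuous.
have cmh : {within `[a, a + 2 * e], continuous (fun t => m t * hat a e t)}.
  by move=> t; apply: cvgM; [exact: cm|exact: ch].
have cch : {within `[a, a + 2 * e], continuous (fun t => c * hat a e t)}.
  by move=> t; apply: cvgM; [exact: cvg_cst|exact: ch].
have cd : {within `[a, a + 2 * e], continuous (fun t => m t * hat a e t - c * hat a e t)}.
  by move=> t; apply: cvgB; [exact: cmh|exact: cch].
have ceh : {within `[a, a + 2 * e], continuous (fun t => eps * hat a e t)}.
  by move=> t; apply: cvgM; [exact: cvg_cst|exact: ch].
have -> : c = \int[leb]_(t in `[a, a + 2 * e]) (c * hat a e t).
  by rewrite RintegralZl ?Rintegral_hat ?mulr1//; exact: integrable_itv.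
rewrite -RintegralB//; [|exact: integrable_itv..].
have -> : eps = \int[leb]_(t in `[a, a + 2 * e]) (eps * hat a e t).
  by rewrite RintegralZl ?Rintegral_hat ?mulr1//; exact: integrable_itv.
apply: le_trans (le_normr_Rintegral _ _) _ => //; first exact: integrable_itv.
apply: le_Rintegral => //.
- by have := integrable_norm (integrable_itv cd).
- exact: integrable_itv.
- move=> t; rewrite /= in_itv/= => /mc tc.
  by rewrite -mulrBl normrM (ger0_norm (hat_ge0 _ _ e0)) ler_wpM2r// hat_ge0.
Qed.

Lemma Rintegral_1minus_plateau q a b e M : 0 < e -> a + 4 * e <= b ->
  measurable_fun `[a, b] q ->
  {ae leb, forall t, a <= t <= b -> `|q t| <= M} ->
  `|\int[leb]_(t in `[a, b]) q t - \int[leb]_(t in `[a, b]) (q t * plateau a b e t)|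
    <= 4 * `|M| * e.
Proof.
move=> e0 ab mq qM.
have qM' : {ae leb, forall t, `[a, b]%classic t -> `|q t| <= `|M|}.
  apply: ae_imply qM => t qM; rewrite /= in_itv/= => /qM {}qM.
  by rewrite (le_trans qM)// ler_norm.
have fin := lebesgue_itv_lty a b.
have mp : measurable_fun `[a, b] (plateau a b e).
  apply: measurable_funTS; apply: continuous_measurable_fun => t.
  apply: differentiable_continuous; apply/derivable1_diffP.
  by have [] := is_derive_plateau a b t e0.
have iq : leb.-integrable `[a, b] (EFin \o q) by exact: ae_bounded_integrable qM'.
have iqp : leb.-integrable `[a, b] (EFin \o (fun t => q t * plateau a b e t)).
  apply: (@ae_bounded_integrable _ _ _ _ _ _ `|M|) => //.
    exact: measurable_funM.
  apply: ae_imply qM' => t qM' /qM' {}qM'; rewrite normrM -[leRHS]mulr1.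
  by rewrite ler_pM//; have := plateau01 t e0 ab => /andP[? ?]; rewrite ger0_norm.
have iqB : leb.-integrable `[a, b] (EFin \o (fun t => q t - q t * plateau a b e t)).
  by have := integrableB _ iq iqp; apply.
rewrite -RintegralB//; apply: le_trans (le_normr_Rintegral _ iqB) _ => //.
pose A := `[a, a + 2 * e]%classic; pose B := `[b - 2 * e, b]%classic.
have iA (C : set R) : measurable C -> leb.-integrable `[a, b] (EFin \o \1_C).
  move=> mC; apply: (@ae_bounded_integrable _ _ _ _ _ _ 1) => //.
  by apply: aeW => t _; rewrite indicE; case: (_ \in _); rewrite ?normr1// normr0.
have mA : measurable (A : set R) by exact: measurable_itv.
have mB : measurable (B : set R) by exact: measurable_itv.
have iAB : leb.-integrable `[a, b] (EFin \o (fun t => \1_A t + \1_B t)).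
  by have := integrableD _ (iA A mA) (iA B mB); apply.
have iAE x y : a <= x -> y <= b -> x < y ->
    \int[leb]_(t in `[a, b]) \1_(`[x, y]%classic) t = y - x.
  move=> ax yb xy; rewrite /Rintegral integral_indic//.
  have lxy : leb `[x, y]%classic = (y - x)%:E by rewrite lebesgue_measure_itv/= lte_fin xy.
  rewrite (_ : _ `&` _ = `[x, y]%classic); first exact: (congr1 fine lxy).
  apply/setIidPl => t /=; rewrite !in_itv/= => /andP[xt ty].
  by rewrite (le_trans ax xt) (le_trans ty yb).
have -> : 4 * `|M| * e = \int[leb]_(t in `[a, b]) (`|M| * (\1_A t + \1_B t)).
  rewrite RintegralZl//.
  rewrite RintegralD//; [|exact: iA..].
  by rewrite !iAE; lra.
apply: ae_le_Rintegral => //.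
- exact: integrable_norm iqB.
- by have := integrableZl _ `|M| iAB; apply.
apply: ae_imply qM' => t qM' tab; have {}qM' := qM' tab.
rewrite -[X in `|X - _|]mulr1 -mulrBr normrM ler_pM//.
have /andP[p0 p1] := plateau01 t e0 ab; rewrite ger0_norm ?subr_ge0// !indicE.
have [tA|tA] := boolP (t \in A).
  by case: (_ \in B) => /=; lra.
have [tB|tB] := boolP (t \in B); first by rewrite add0r lerBlDr lerDl.
move: tA tB tab; rewrite !notin_setE /A /B /= !in_itv/= => /negP + /negP + /andP[ta tb].
rewrite ta tb andbT/= -!ltNge => tA tB.
by rewrite plateau1// ?subrr//; lra.
Qed.

(** Tested with a plateau, whose derivative is a difference of two hats, the
    identity compares averages of [m] near [a] and [b] with an integral of [q]
    over nearly all of [[a, b]]. *)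
Lemma weak_derivative_increment m q a b M : 0 < a -> a < b ->
  (forall t, 0 < t -> {for t, continuous m}) ->
  measurable_fun `[a, b] q -> {ae leb, forall t, a <= t <= b -> `|q t| <= M} ->
  (forall theta, test_function theta ->
    \int[leb]_(t in `]0, +oo[) (m t * derive1 theta t) =
    - \int[leb]_(t in `]0, +oo[) (q t * theta t)) ->
  m b - m a = \int[leb]_(t in `[a, b]) q t.
Proof.
move=> a0 ab cm mq qM wd.
apply/eqP; rewrite -subr_eq0 -normr_le0; apply/ler_addgt0Pr => eps eps0; rewrite add0r.
have near_m c : 0 < c -> exists2 d : R, 0 < d & forall t, `|t - c| < d -> `|m t - m c| <= eps / 3.
  move=> c0; have /cvgrPdist_le/(_ (eps / 3)) := cm c c0.
  move=> /(_ ltac:(lra))/nbhs_ballP[d/= d0 dm]; exists d => // t tc.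
  by rewrite distrC; apply: dm; rewrite /ball/= distrC.
have [da da0 ma] := near_m a a0; have [db db0 mb] := near_m b (lt_trans a0 ab).
(* [4 e] is the total length of the two transitions of the plateau, which must
   fit in [[a, b]] and carry at most [eps / 3] of the integral of [q]. *)
pose e := Num.min (Num.min da db) (Num.min (b - a) (eps / (3 * (`|M| + 1)))) / 5.
have M0 : 0 < `|M| + 1 by rewrite ltr_wpDl.
have r0 : 0 < eps / (3 * (`|M| + 1)) by rewrite divr_gt0// mulr_gt0.
have e0 : 0 < e by rewrite divr_gt0// !lt_min da0 db0 r0 subr_gt0 ab.
have [eda edb eab eM] : [/\ 5 * e <= da, 5 * e <= db, 5 * e <= b - a &
    5 * e <= eps / (3 * (`|M| + 1))].
  have -> : 5 * e = Num.min (Num.min da db) (Num.min (b - a) (eps / (3 * (`|M| + 1)))).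
    by rewrite /e mulrC divfK.
  by split; rewrite !ge_min lexx ?orbT.
clearbody e.
have ab4 : a + 4 * e <= b by lra.
have cw x y : 0 < x -> {within `[x, y], continuous m}.
  move=> x0; apply: continuous_in_subspaceT => t /set_mem/=; rewrite in_itv/= => /andP[xt _].
  by apply: cm; exact: lt_le_trans xt.
have Ha := @hat_average m a e (m a) (eps / 3) e0 (cw _ _ a0).
have b0 : 0 < b - 2 * e by lra.
have Hb := @hat_average m (b - 2 * e) e (m b) (eps / 3) e0 (cw _ _ b0).
have {}Ha := Ha ltac:(by move=> t /andP[t1 t2]; apply: ma; rewrite ger0_norm; lra).
have {}Hb := Hb ltac:(by move=> t /andP[t1 t2]; apply: mb; rewrite ler0_norm; lra).
have HM := Rintegral_1minus_plateau e0 ab4 mq qM.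
have ii x (f : R -> R) : 0 < x -> (forall t, t \notin `[x, x + 2 * e] -> f t = 0) ->
    \int[leb]_(t in `]0, +oo[) f t = \int[leb]_(t in `[x, x + 2 * e]) f t.
  move=> x0 f0; apply: Rintegral_support => t /=; rewrite !in_itv/=.
    by move=> /andP[xt _]; rewrite andbT; exact: lt_le_trans xt.
  by move=> _ /negP tx; apply: f0; rewrite in_itv.
have ih x : 0 < x -> leb.-integrable `]0, +oo[ (EFin \o (fun t => m t * hat x e t)).
  move=> x0; have : leb.-integrable `[x, x + 2 * e] (EFin \o (fun t => m t * hat x e t)).
    apply: integrable_itv => t; apply: cvgM; first exact: cw.
    by apply: continuous_subspaceT; exact: hat_continuous.
  rewrite integrable_mkcond// => h; rewrite integrable_mkcond//.
  move: h; apply: eq_integrable => // t _; rewrite /patch.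
  case: ifPn => [tx|tx].
    rewrite mem_set//; move/set_mem: tx; rewrite /= !in_itv/= => /andP[xt _].
    by rewrite andbT; exact: lt_le_trans xt.
  case: ifPn => // _ /=; rewrite hat_out ?mulr0//.
  by apply/negP => tx'; move: tx; rewrite mem_set.
have := wd _ (test_function_plateau a0 e0 ab4).
have -> : \int[leb]_(t in `]0, +oo[) (q t * plateau a b e t) =
    \int[leb]_(t in `[a, b]) (q t * plateau a b e t).
  apply: Rintegral_support => t /=; rewrite !in_itv/=.
    by move=> /andP[xt _]; rewrite andbT; exact: lt_le_trans xt.
  move=> _ /negP; rewrite negb_and -!ltNge /plateau => /orP[] ta.
    by rewrite !step0 ?subr0 ?mulr0//; lra.
  by rewrite !step1 ?subrr ?mulr0//; lra.
under eq_Rintegral do rewrite derive1_plateau// mulrBr.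
rewrite RintegralB//; [|exact: ih..].
rewrite (ii a)//; last by move=> t ta; rewrite hat_out ?mulr0.
rewrite (ii (b - 2 * e))//; last by move=> t ta; rewrite hat_out ?mulr0.
move: Ha Hb HM.
set Ia := (X in `|X - m a|); set Ib := (X in `|X - m b|).
set Iq := (X in `|X - _| <= _ * e); set Iqp := (X in `|_ - X| <= _ * e) => Ha Hb HM E.
have HM' : 4 * `|M| * e <= eps / 3.
  apply: (@le_trans _ _ ((`|M| + 1) * (5 * e))); first by have := normr_ge0 M; nra.
  apply: le_trans (_ : (`|M| + 1) * (eps / (3 * (`|M| + 1))) <= _).
    by rewrite ler_pM2l.
  by rewrite le_eqVlt; apply/orP; left; apply/eqP; field; rewrite gt_eqF.
have {}HM := le_trans HM HM'.
have {}E : Ia - Ib = - Iqp by exact: E.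
suff : `|m b - m a - Iq| <= eps by [].
clearbody Ia Ib Iq Iqp; clear -Ha Hb HM E.
by move: Ha Hb HM; rewrite !ler_norml => /andP[? ?] /andP[? ?] /andP[? ?]; lra.
Qed.

End WeakDerivative.

(** * Energy inequality along curves in $L^2$ *)

Section Evolution.
Context d (T : measurableType d) (R : realType) (mu : {measure set T -> \bar R}).
Local Notation H := (L2 mu).
Local Notation leb := (@lebesgue_measure R).
Implicit Types (u g : R -> H) (h v : H) (a b : R).

Lemma L2dot_norm_le v h : `|L2dot v h| <= `|v| * `|h|.
Proof.
rewrite ler_norml L2_cauchy_schwarz andbT lerNl -L2dotNl.
by rewrite -(normrN v) L2_cauchy_schwarz.
Qed.

Lemma L2dot_continuous h : continuous (fun v : H => L2dot v h).
Proof.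
move=> v; have Fv : Filter (nbhs v) by exact: nbhs_filter.
apply/(@cvgrPdist_le _ _ _ _ Fv) => e e0.
have h0 : 0 < `|h| + 1 by rewrite ltr_wpDl.
have /nbhs_ballP : exists2 r : R, 0 < r & ball v r `<=` [set w | `|L2dot v h - L2dot w h| <= e].
  exists (e / (`|h| + 1)); first by rewrite divr_gt0.
  move=> w; rewrite -ball_normE /= ltr_pdivlMr// => vw.
  rewrite -L2dotBl (le_trans (L2dot_norm_le _ _))//.
  by apply: le_trans (ltW vw); rewrite ler_wpM2l// lerDl.
exact.
Qed.

Lemma simple_fun_dot_measurable (s : R -> H) h : simple_fun s ->
  measurable_fun setT ((fun t => L2dot (s t) h) : R -> R).
Proof.
move=> [fs ms] _ B mB; rewrite setTI.
rewrite (_ : _ @^-1` B = \bigcup_(k in range s `&` [set k | B (L2dot k h)]) (s @^-1` [set k])).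
  apply: fin_bigcup_measurable; first exact: finite_setIl.
  by move=> k _; exact: ms.
apply/seteqP; split=> [t /= Bt|t [k [_ /= Bk] /= ->//]].
by exists (s t) => //; split => //; exists t.
Qed.

Lemma strongly_measurable_dot g h : strongly_measurable g ->
  measurable_fun `](0 : R), +oo[ ((fun t => L2dot (g t) h) : R -> R).
Proof.
move=> [s [ss sg]].
apply: (@measurable_fun_cvg _ _ _ _ (fun n t => L2dot (s n t) h)).
- by move=> n; apply: measurable_funTS; exact: simple_fun_dot_measurable.
- move=> t; rewrite /= in_itv/= andbT => t0.
  by have := cvg_comp _ _ (sg t t0) (@L2dot_continuous h (g t)); exact.
Qed.

Definition has_weak_derivative u g := [/\ forall t, 0 < t -> {for t, continuous u},
  strongly_measurable g, locally_ess_bounded g & weak_derivative u g].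

Lemma ess_bound g a b : locally_ess_bounded g -> 0 < a -> exists2 M : R, 0 <= M &
  {ae leb, forall t, a <= t <= b -> `|g t| <= M}.
Proof.
move=> lg a0; have [M gM] := lg a b a0; exists `|M| => //.
by apply: ae_imply gM => t gM /gM {}gM; rewrite (le_trans gM)// ler_norm.
Qed.

Lemma dot_measurable_itv u g h a b : has_weak_derivative u g -> 0 < a ->
  measurable_fun `[a, b] ((fun t => L2dot (g t) h) : R -> R).
Proof.
move=> [_ mg _ _] a0; apply: measurable_funS (strongly_measurable_dot h mg) => //.
by move=> t; rewrite /= !in_itv/= andbT => /andP[+ _]; exact: lt_le_trans.
Qed.

Lemma dot_ess_bound g h a b M :
  {ae leb, forall t, a <= t <= b -> `|g t| <= M} ->
  {ae leb, forall t, a <= t <= b -> `|L2dot (g t) h| <= M * `|h|}.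
Proof.
apply: ae_imply => t gM /gM {}gM; apply: le_trans (L2dot_norm_le _ _) _.
by rewrite ler_wpM2r.
Qed.

Lemma dot_integrable u g h a b : has_weak_derivative u g -> 0 < a ->
  leb.-integrable `[a, b] (EFin \o (fun t => L2dot (g t) h)).
Proof.
move=> ug a0; have [_ _ lg _] := ug; have [M M0 gM] := ess_bound b lg a0.
apply: (@ae_bounded_integrable _ _ _ _ _ _ (M * `|h|)) => //.
- exact: lebesgue_itv_lty.
- exact: dot_measurable_itv ug a0.
- apply: ae_imply (dot_ess_bound h gM) => t + tab; apply.
  by move: tab; rewrite /= in_itv.
Qed.

Lemma dot_increment u g h a b : has_weak_derivative u g -> 0 < a -> a < b ->
  L2dot (u b - u a) h = \int[leb]_(t in `[a, b]) L2dot (g t) h.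
Proof.
move=> ug a0 ab; have [cu _ lg wd] := ug; have [M M0 gM] := ess_bound b lg a0.
rewrite L2dotBl.
apply: (@weak_derivative_increment R (fun t => L2dot (u t) h)
  (fun t => L2dot (g t) h) a b (M * `|h|)) => //.
- move=> t t0.
  by have := cvg_comp _ _ (cu t t0) (@L2dot_continuous h (u t)); exact.
- exact: dot_measurable_itv ug a0.
- exact: dot_ess_bound gM.
- by move=> theta tt; exact: wd.
Qed.

(** The two curves are taken together because the bounds to come hold only for
    the sum of the two products. *)
Lemma pair_increment_le u1 g1 u2 g2 h1 h2 a b (c : R) :
  has_weak_derivative u1 g1 -> has_weak_derivative u2 g2 -> 0 < a -> a <= b ->
  {ae leb, forall t, a <= t <= b -> L2dot (g1 t) h1 + L2dot (g2 t) h2 <= c} ->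
  L2dot (u1 b - u1 a) h1 + L2dot (u2 b - u2 a) h2 <= c * (b - a).
Proof.
move=> ug1 ug2 a0; rewrite le_eqVlt => /predU1P[<-|ab] gc.
  by rewrite !subrr !L2dot0l addr0 mulr0.
rewrite (dot_increment h1 ug1)// (dot_increment h2 ug2)//.
have i1 := dot_integrable h1 b ug1 a0; have i2 := dot_integrable h2 b ug2 a0.
rewrite -RintegralD//.
have -> : c * (b - a) = \int[leb]_(t in `[a, b]) (cst c t).
  have lab : leb `[a, b]%classic = (b - a)%:E by rewrite lebesgue_measure_itv/= lte_fin ab.
  rewrite Rintegral_cst//; congr (_ * _); exact: (congr1 fine (esym lab)).
apply: ae_le_Rintegral => //.
- by have := integrableD _ i1 i2; apply.
- by apply: integrable_itv => t; exact: cvg_cst.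
Qed.

Lemma weak_derivative_lipschitz u g a b : has_weak_derivative u g -> 0 < a ->
  exists2 L : R, 0 <= L & forall s t, a <= s -> s <= t -> t <= b ->
    `|u t - u s| <= L * (t - s).
Proof.
move=> ug a0; have [_ _ lg _] := ug; have [M M0 gM] := ess_bound b lg a0.
exists M => // s t as_ st tb; pose h := u t - u s.
have := @pair_increment_le u g u g h 0 s t (M * `|h|) ug ug (lt_le_trans a0 as_) st.
rewrite L2dot0r addr0 -/h -L2norm_sqr => /(_ _)/wrap[].
  apply: ae_imply gM => r gM /andP[sr rt]; rewrite L2dot0r addr0.
  apply: le_trans (L2_cauchy_schwarz _ _) _; rewrite ler_wpM2r// gM//.
  by rewrite (le_trans as_ sr) (le_trans rt tb).
rewrite -/h; have [->|h0] := eqVneq h 0.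
  by rewrite normr0 => _; rewrite mulr_ge0// subr_ge0.
by rewrite expr2 -mulrA mulrCA ler_pM2l// normr_gt0.
Qed.

(** Errors quadratic in the length of an interval disappear under subdivision. *)
Lemma quadratic_increment (F : R -> R) a b (c C : R) : 0 <= C -> a <= b ->
  (forall s t, a <= s -> s <= t -> t <= b -> F t - F s <= (c + C * (t - s)) * (t - s)) ->
  F b - F a <= c * (b - a).
Proof.
move=> C0 ab hF; apply/ler_addgt0Pr => e e0.
have [n nE] : exists n : nat, C * (b - a) ^+ 2 / e < n.+1%:R.
  exists (Num.bound (C * (b - a) ^+ 2 / e)).
  apply: lt_le_trans (archi_boundP _) _; last by rewrite ler_nat.
  by apply: divr_ge0; [exact: mulr_ge0 C0 (sqr_ge0 _)|exact: ltW].
pose D := (b - a) / n.+1%:R.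
have n0 : 0 < n.+1%:R :> R by rewrite ltr0n.
have D0 : 0 <= D by rewrite divr_ge0// ?subr_ge0// ltW.
have part k : (k <= n.+1)%N -> F (a + k%:R * D) - F a <= (c + C * D) * (k%:R * D).
  elim: k => [|k ih] kn; first by rewrite mul0r addr0 subrr mulr0.
  have kD : k.+1%:R * D <= b - a.
    by rewrite /D mulrCA ler_piMr ?subr_ge0// ler_pdivrMr// mul1r ler_nat.
  have kD0 : 0 <= k%:R * D by rewrite mulr_ge0.
  have kE : k.+1%:R * D = k%:R * D + D by rewrite -natr1 mulrDl mul1r.
  have := ih (ltnW kn).
  have := hF (a + k%:R * D) (a + k.+1%:R * D) ltac:(lra) ltac:(lra) ltac:(lra).
  by rewrite kE; nra.
have := part n.+1 (leqnn _).
have -> : n.+1%:R * D = b - a by rewrite /D mulrC divfK// gt_eqF.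
rewrite subrKC => h; apply: le_trans h _; rewrite mulrDl lerD2l.
rewrite (_ : C * D * (b - a) = C * (b - a) ^+ 2 / n.+1%:R); last first.
  by rewrite /D; field; rewrite gt_eqF.
by move: nE; rewrite ltr_pdivrMr// ler_pdivrMr// (mulrC e) => /ltW.
Qed.

(** A chain rule for an energy [F] with Lipschitz gradient [(G1, G2)]: on [[s, t]]
    the gradient can be frozen at time [t] at a cost quadratic in [t - s]. *)
Lemma energy_increment_le u1 g1 u2 g2 (F : R -> R) (G1 G2 : R -> H) a b (c K : R) :
  has_weak_derivative u1 g1 -> has_weak_derivative u2 g2 ->
  0 < a -> a <= b -> 0 <= K ->
  (forall s t, a <= s -> s <= t -> t <= b ->
    F t - F s <= L2dot (u1 t - u1 s) (G1 t) + L2dot (u2 t - u2 s) (G2 t)) ->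
  (forall s t, a <= s -> s <= t -> t <= b ->
    `|G1 t - G1 s| <= K * (`|u1 t - u1 s| + `|u2 t - u2 s|) /\
    `|G2 t - G2 s| <= K * (`|u1 t - u1 s| + `|u2 t - u2 s|)) ->
  {ae leb, forall t, a <= t <= b ->
    L2dot (g1 t) (G1 t) + L2dot (g2 t) (G2 t) <= c} ->
  F b - F a <= c * (b - a).
Proof.
move=> ug1 ug2 a0 ab K0 FG GL gc.
have [_ _ lg1 _] := ug1; have [M1 M10 gM1] := ess_bound b lg1 a0.
have [_ _ lg2 _] := ug2; have [M2 M20 gM2] := ess_bound b lg2 a0.
have [L1 L10 uL1] := weak_derivative_lipschitz b ug1 a0.
have [Lb Lb0 uLb] := weak_derivative_lipschitz b ug2 a0.
pose C := (M1 + M2) * (K * (L1 + Lb)).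
have C0 : 0 <= C by rewrite !mulr_ge0// addr_ge0.
apply: (quadratic_increment C0 ab) => s t as_ st tb.
apply: le_trans (FG s t as_ st tb) _.
apply: (@pair_increment_le u1 g1 u2 g2 (G1 t) (G2 t) s t (c + C * (t - s))
  ug1 ug2 (lt_le_trans a0 as_) st).
apply: ae_imply3 gM1 gM2 gc => r gM1' gM2' gc' /andP[sr rt].
have rab : a <= r <= b by rewrite (le_trans as_ sr) (le_trans rt tb).
move: (gM1' rab) (gM2' rab) (gc' rab) => {}gM1' {}gM2' {}gc'.
have [ar rb] := andP rab.
have [GL1 GL2] := GL r t ar rt tb.
have E : `|u1 t - u1 r| + `|u2 t - u2 r| <= (L1 + Lb) * (t - s).
  rewrite mulrDl lerD//.
    by apply: le_trans (uL1 r t ar rt tb) _; rewrite ler_wpM2l// lerD2l lerN2.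
  by apply: le_trans (uLb r t ar rt tb) _; rewrite ler_wpM2l// lerD2l lerN2.
have {}GL1 : `|G1 t - G1 r| <= K * (L1 + Lb) * (t - s).
  by apply: le_trans GL1 _; rewrite -mulrA ler_wpM2l.
have {}GL2 : `|G2 t - G2 r| <= K * (L1 + Lb) * (t - s).
  by apply: le_trans GL2 _; rewrite -mulrA ler_wpM2l.
have D1 : L2dot (g1 r) (G1 t - G1 r) <= M1 * (K * (L1 + Lb) * (t - s)).
  by apply: le_trans (L2_cauchy_schwarz _ _) _; rewrite ler_pM.
have D2 : L2dot (g2 r) (G2 t - G2 r) <= M2 * (K * (L1 + Lb) * (t - s)).
  by apply: le_trans (L2_cauchy_schwarz _ _) _; rewrite ler_pM.
rewrite /C; move: D1 D2; rewrite !L2dotBr => D1 D2.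
rewrite -(subrK (L2dot (g1 r) (G1 r)) (L2dot (g1 r) (G1 t))).
rewrite -(subrK (L2dot (g2 r) (G2 r)) (L2dot (g2 r) (G2 t))).
by lra.
Qed.

End Evolution.

(** * Subgradients and minima over fibers *)

Lemma ereal_real (R : realType) (x : \bar R) : (-oo < x)%E -> (x < +oo)%E ->
  exists r : R, x = r%:E.
Proof. by case: x => // r _ _; exists r. Qed.

Section Subgradients.
Context d (T : measurableType d) (R : realType) (mu : {measure set T -> \bar R}).
Local Notation H := (L2 mu).
Variables (V : tvsType R) (phi : V -> \bar R) (j : {linear V -> H}).
Hypothesis phi_ninfty : no_ninfty phi.
Hypothesis phi_convex : econvex phi.

(** The global form of the subgradient relation, which for convex functionals is
    equivalent to the one through lower limits of difference quotients. *)
Definition exact_minorant (w : V) (y : H) (p : R) := phi w = p%:E /\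
  forall v, ((p + L2dot y (j v - j w))%:E <= phi v)%E.

Lemma convex_real (v w : V) (p q t : R) : phi v = p%:E -> phi w = q%:E ->
  0 <= t <= 1 -> (phi (t *: v + (1 - t) *: w)%R <= (t * p + (1 - t) * q)%:E)%E.
Proof. by move=> vp wq t01; have := phi_convex v w t01; rewrite vp wq. Qed.

(** By convexity the difference quotient at [t <= 1] is at most the one at 1. *)
Lemma jsubgradient_exact_minorant u f : jsubgradient phi j (u, f) ->
  exists w p, j w = u /\ exact_minorant w f p.
Proof.
move=> [w [/= dw jw fw]].
have [p wp] := ereal_real (phi_ninfty w) dw.
exists w, p; split => //; split => // v.
have [->|voo] := eqVneq (phi v) +oo%E; first by rewrite leey.
have [q vq] := ereal_real (phi_ninfty v) ltac:(by rewrite ltey).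
rewrite vq lee_fin -lerBrDl -lee_fin -linearB.
apply: le_trans (fw (v - w)) _; rewrite limf_einfE.
apply: ub_ereal_sup => _ [B B0 <-].
have [e /= e0 eB] : exists2 e : R, 0 < e & forall t, 0 < t < e -> B t.
  move: B0; rewrite /at_right /within/= => /nbhs_ballP[e/= e0 he]; exists e => //.
  move=> t /andP[t0 te]; apply: he => //.
  by rewrite /ball/= sub0r normrN gtr0_norm.
pose t := Num.min (e / 2) 1.
have t0 : 0 < t by rewrite lt_min divr_gt0//= ltr01.
have t1 : t <= 1 by rewrite ge_min lexx orbT.
have te : t < e by rewrite gt_min; apply/orP; left; lra.
apply: (@le_trans _ _ ((phi (w + t *: (v - w))%R - phi w) * (t^-1)%:E)%E).
  by apply: ereal_inf_lbound; exists t => //; apply: eB; rewrite t0.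
have -> : w + t *: (v - w) = t *: v + (1 - t) *: w.
  by rewrite scalerBr scalerBl scale1r addrCA addrC addrAC -addrA (addrC w).
have := convex_real vq wp (t := t) ltac:(by rewrite t1 ltW).
have := phi_ninfty (t *: v + (1 - t) *: w).
case: (phi _) => [r _| |//]; last by rewrite leye_eq.
rewrite wp lee_fin => h.
have -> : ((r%:E - p%:E) * (t^-1)%:E = ((r - p) / t)%:E)%E by [].
by rewrite lee_fin ler_pdivrMr//; lra.
Qed.

Lemma exact_minorant_jsubgradient w y p : exact_minorant w y p -> jsubgradient phi j (j w, y).
Proof.
move=> [wp sw]; exists w; split => //=; first by rewrite /effdom/= wp ltry.
move=> v; rewrite limf_einfE; apply: ereal_sup_ge.
exists (ereal_inf ((fun t => (phi (w + t *: v)%R - phi w) * t^-1%:E)%E @` [set t : R | 0 < t])).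
  by exists [set t : R | 0 < t] => //; exact: nbhs_right_gt.
apply: le_ereal_inf_tmp => _ [t /= t0 <-].
have := sw (w + t *: v); rewrite wp -linearB addrAC subrr add0r linearZ/= L2dotZr.
have := phi_ninfty (w + t *: v).
case: (phi _) => [r _|_ _|//]; last by rewrite addye// mulyr gtr0_sg ?invr_gt0// mul1e leey.
have -> : ((r%:E - p%:E) * (t^-1)%:E = ((r - p) / t)%:E)%E by [].
by rewrite !lee_fin ler_pdivlMr// => h; lra.
Qed.

End Subgradients.

Section FiberMinima.
Context d (T : measurableType d) (R : realType) (mu : {measure set T -> \bar R}).
Local Notation H := (L2 mu).
Variables (V : tvsType R) (phi : V -> \bar R) (j : {linear V -> H}).
Hypothesis phi_ninfty : no_ninfty phi.
Hypothesis phi_convex : econvex phi.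
Hypothesis phi_proper : eproper phi.
Hypothesis phi_lsc : lsc phi.
Hypothesis weak_j : weak_continuous j.
Variable omega : R.
Hypothesis omega0 : 0 <= omega.
Hypothesis phi_coercive :
  coercive (fun v => (phi v + (omega / 2 * `|j v| ^+ 2)%:E)%E).

Lemma sublevel_weakly_closed (c : R) :
  closed ([set v | (phi v <= c%:E)%E] : set (weak V)).
Proof.
apply: closed_convex_weakly_closed; first exact: phi_lsc.
move=> t x y t01 /= xc yc; apply: le_trans (phi_convex x y t01) _.
have /andP[t0 t1] := t01.
have -> : c%:E = (t%:E * c%:E + (1 - t)%:E * c%:E)%E.
  by rewrite -!EFinM -EFinD -mulrDl addrC subrK mul1r.
by apply: leeD; apply: lee_wpmul2l => //; rewrite lee_fin// subr_ge0.
Qed.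

Lemma dot_weakly_continuous h : continuous ((fun v => L2dot (j v) h) : weak V -> R^o).
Proof.
have lin : linear ((fun v : H => L2dot v h) : H -> R^o).
  by move=> a u v; rewrite L2dotDl L2dotZl.
pose l : {linear H -> R^o} := HB.pack ((fun v : H => L2dot v h) : H -> R^o)
  (GRing.isLinear.Build R H R^o *:%R _ lin).
have lc : continuous l by exact: L2dot_continuous.
move=> v; have := cvg_comp _ _ (@weak_j v)
  (@weak_topdual_continuous R H (exist _ l lc) (j v)).
exact.
Qed.

Definition penalized (kappa : R) (f : H) (v : V) : \bar R :=
  (phi v + (kappa / 2 * `|j v - f| ^+ 2)%:E)%E.

(** Weakly lower semicontinuous because [|x|^2/2] is the supremum of the affine
    functions [<x, h> - |h|^2/2]. *)
Lemma penalized_weakly_closed kappa f (c : R) : 0 < kappa ->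
  closed ([set v | (penalized kappa f v <= c%:E)%E] : set (weak V)).
Proof.
move=> k0 v cv; apply: contrapT => /= /negP; rewrite -ltNge => vc.
(* The supporting affine function at [j v] detects that [v] is outside. *)
pose h := j v - f.
pose l (w : V) : R := kappa * L2dot (j w) h - kappa * L2dot f h - kappa / 2 * `|h| ^+ 2.
have lE w : l w <= kappa / 2 * `|j w - f| ^+ 2.
  have := sqr_ge0 `|j w - f - h|; rewrite L2norm_sqrB L2dotBl /l; nra.
have lv : l v = kappa / 2 * `|j v - f| ^+ 2.
  by rewrite /l -/h -mulrBr -L2dotBl -/h L2norm_sqr; lra.
have [r [rv rc]] : exists r : R, (r%:E < phi v)%E /\ c - r < l v.
  move: vc; rewrite /penalized -lv; have := phi_ninfty v.
  case: (phi v) => [q _| _ _|//].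
  - rewrite -EFinD lte_fin => qc; exists (q - (q + l v - c) / 2).
    by rewrite lte_fin; split; lra.
  - by exists (c - l v + 1); rewrite ltry; split => //; lra.
have lc : continuous (l : weak V -> R^o).
  pose a (x : R) := kappa * x - kappa * L2dot f h - kappa / 2 * `|h| ^+ 2.
  have ac : continuous a.
    move=> x; apply: cvgB; last exact: cvg_cst.
    apply: cvgB; last exact: cvg_cst.
    by apply: cvgM; [exact: cvg_cst|exact: cvg_id].
  by move=> w; have := cvg_comp _ _ (@dot_weakly_continuous h w) (ac _); exact.
have n1 : nbhs (v : weak V) [set w | ~ (phi w <= r%:E)%E].
  apply: open_nbhs_nbhs; split; last by move=> /=; apply/negP; rewrite -ltNge.
  by have := closed_openC (@sublevel_weakly_closed r).
have n2 : nbhs (v : weak V) [set w | c - r < l w].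
  by apply: (lc v [set x | c - r < x]); exact: lt_nbhsr.
have [w [/= wc [/negP wr lw]]] := cv _ (filterI n1 n2).
move: wr wc; rewrite -ltNge /penalized => wr.
have := lE w => lEw; move: wr; case: (phi w) => [q|_|//].
  by rewrite lte_fin -EFinD lee_fin; lra.
by rewrite addye.
Qed.

Lemma penalized_ninfty kappa f v : (-oo < penalized kappa f v)%E.
Proof.
rewrite /penalized; have := phi_ninfty v; case: (phi v) => [r _|_|//].
  by rewrite -EFinD ltNyr.
by rewrite addye.
Qed.

Lemma phi_omega_le_penalized kappa f v : 2 * omega <= kappa ->
  (phi v + (omega / 2 * `|j v| ^+ 2)%:E <=
   penalized kappa f v + (omega * `|f| ^+ 2)%:E)%E.
Proof.
move=> ok; rewrite /penalized -addeA -EFinD leeD2l// lee_fin.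
have := sqr_ge0 `|j v - f - f|; rewrite L2norm_sqrB.
have -> : `|j v| ^+ 2 = `|j v - f + f| ^+ 2 by rewrite subrK.
rewrite (L2norm_sqrD (j v - f) f); set A := `|j v - f| ^+ 2; set B := L2dot _ _.
set C := `|f| ^+ 2 => h.
have A0 : 0 <= A by exact: sqr_ge0.
have C0 : 0 <= C by exact: sqr_ge0.
have := mulr_ge0 omega0 h; have : 0 <= (kappa - 2 * omega) * A by apply: mulr_ge0; lra.
by lra.
Qed.

(** The sublevel sets of the penalized functional that meet the domain form a
    chain of nonempty weakly closed subsets of a weakly compact set. *)
Lemma penalized_minimizer kappa f : 0 < kappa -> 2 * omega <= kappa ->
  exists v, forall w, (penalized kappa f v <= penalized kappa f w)%E.
Proof.
move=> k0 ok; pose P := penalized kappa f.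
have [v0 dv0] := phi_proper.
have [r0 r0E] : exists r0 : R, P v0 = r0%:E.
  have [q qE] := ereal_real (phi_ninfty v0) dv0.
  by rewrite /P /penalized qE -EFinD; eexists.
pose F : set_system (weak V) :=
  [set B | exists2 v, (P v <= r0%:E)%E & [set w | (P w <= P v)%E] `<=` B].
have FF : ProperFilter F.
  split; first by move=> [v _ /(_ v)]; apply => /=.
  split.
  - by exists v0; rewrite ?r0E.
  - move=> A B [v vr vA] [w wr wB].
    have [vw|wv] := leP (P v) (P w).
      exists v => // z /= zv; split; first exact: vA.
      by apply: wB; exact: le_trans zv vw.
    exists w => // z /= zw; split; last exact: wB.
    by apply: vA; apply: le_trans zw (ltW wv).
  - by move=> A B AB [v vr vA]; exists v => // z /vA /AB.
have := @phi_coercive (r0 + omega * `|f| ^+ 2) F FF.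
move=> []; last first.
  move=> p [_ pF].
  have pP v : (P v <= r0%:E)%E -> (P p <= P v)%E.
    move=> vr; have [q qE] := ereal_real (penalized_ninfty kappa f v) (le_lt_trans vr (ltry r0)).
    rewrite /P qE; apply: (penalized_weakly_closed k0 (f := f)) => B pB.
    apply: pF => //; exists v => // w; rewrite /P qE; exact.
  exists p => w; have [wr|wr] := leP (P w) r0%:E; first exact: pP.
  apply: le_trans (ltW wr).
  by have := pP v0; rewrite r0E; apply.
exists v0; first by rewrite r0E.
move=> w /= wv; apply: (@subset_closure _ (_ : set (weak V))) => /=.
apply: le_trans (phi_omega_le_penalized f w ok) _.
by rewrite EFinD leeD2r// -r0E.
Qed.

(** That is, [j v] is the value at [f] of the resolvent of the [j]-subgradient
    with parameter [1 / kappa]. *)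
Definition resolvent_at kappa f v := exists p, exact_minorant phi j v (kappa *: (f - j v)) p.

(** The first order condition at a minimizer of the penalized functional, along
    segments. *)
Lemma resolvent_exists kappa f : 0 < kappa -> 2 * omega <= kappa ->
  exists v, resolvent_at kappa f v.
Proof.
move=> k0 ok; have [v vmin] := penalized_minimizer f k0 ok.
have [v0 dv0] := phi_proper.
have [q0 q0E] := ereal_real (phi_ninfty v0) dv0.
have [p pE] : exists p, phi v = p%:E.
  apply: ereal_real => //; have := vmin v0; rewrite /penalized q0E.
  by case: (phi v) => [r||]; rewrite ?ltry// addye// leye_eq.
exists v, p; split => // w.
have [->|woo] := eqVneq (phi w) +oo%E; first by rewrite leey.
have [q qE] := ereal_real (phi_ninfty w) ltac:(by rewrite ltey).
rewrite qE lee_fin; apply/ler_addgt0Pr => e e0.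
pose D := `|j w - j v| ^+ 2.
have D0 : 0 <= D by exact: sqr_ge0.
pose t := Num.min 1 (e / (kappa * (D + 1))).
have kD : 0 < kappa * (D + 1) by rewrite mulr_gt0// ltr_wpDl.
have t0 : 0 < t by rewrite lt_min ltr01 divr_gt0.
have t1 : t <= 1 by rewrite ge_min lexx.
have te : t * (kappa * (D + 1)) <= e.
  by rewrite -ler_pdivlMr// ge_min lexx orbT.
have := le_trans (vmin (t *: w + (1 - t) *: v)) (leeD2r _
  (convex_real phi_convex qE pE (t := t) ltac:(by rewrite t1 ltW))).
rewrite /penalized pE -!EFinD lee_fin.
have -> : j (t *: w + (1 - t) *: v) - f = (j v - f) + t *: (j w - j v).
  rewrite linearD !linearZ/= [RHS]addrAC; congr (_ - _).
  by rewrite scalerBr scalerBl scale1r addrCA.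
rewrite (L2norm_sqrD (j v - f) (t *: _)) L2dotZr normrZ exprMn (gtr0_norm t0) -/D.
rewrite L2dotZl -(opprB (j v) f) L2dotNl.
set B := L2dot _ _ => h.
have {}h : 0 <= t * (q - p + kappa * B + kappa / 2 * t * D) by lra.
have {}h : 0 <= q - p + kappa * B + kappa / 2 * t * D by move: h; rewrite pmulr_rge0.
nra.
Qed.

Variable phiH : H -> \bar R.
Hypothesis phiHP : functional_on_H phi j phiH.

Lemma exact_minorant_functional_on_H w y p : exact_minorant phi j w y p ->
  exists q, exact_minorant phiH (idfun : {linear H -> H}) (j w) y q.
Proof.
have [nH cH _ _ sH] := phiHP.
move=> /(exact_minorant_jsubgradient phi_ninfty)/sH/(@jsubgradient_exact_minorant _ _ _ _ H phiH idfun nH cH).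
by move=> [x [q [<- xq]]]; exists q.
Qed.

(** On the domain of the subgradient this turns out to be the additive constant
    between the two functionals. *)
Definition gap w : R := fine (phi w) - fine (phiH (j w)).

(** Both functionals have the affine minorants of slopes [y] and [y'], so their
    increments differ by at most [<y' - y, x' - x>], which is at most quadratic
    in [f' - f]. *)
Lemma gap_increment kappa f f' w w' : 0 < kappa ->
  resolvent_at kappa f w -> resolvent_at kappa f' w' ->
  `|gap w' - gap w| <= kappa * `|f' - f| ^+ 2.
Proof.
move=> k0 [p wp] [p' wp'].
have [q wq] := exact_minorant_functional_on_H wp; have [q' wq'] := exact_minorant_functional_on_H wp'.
have := wp.2 w'; have := wp'.2 w; have := wq.2 (j w'); have := wq'.2 (j w).
rewrite /gap wp.1 wp'.1 wq.1 wq'.1 !lee_fin/=.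
rewrite -(opprB (j w') (j w)) !L2dotNr !L2dotZl.
have := sqr_ge0 `|f' - f - (j w' - j w)|; rewrite L2norm_sqrB.
have -> : L2dot (f' - j w') (j w' - j w) = L2dot (f - j w) (j w' - j w) +
    L2dot (f' - f) (j w' - j w) - `|j w' - j w| ^+ 2.
  by rewrite L2norm_sqr !(L2dotBl, L2dotBr); ring.
set e := L2dot (f' - f) _; set a := L2dot (f - j w) _.
set n := `|f' - f| ^+ 2; set m := `|j w' - j w| ^+ 2 => h1 h2 h3 h4 h5.
have m0 : 0 <= m by exact: sqr_ge0.
have n0 : 0 <= n by exact: sqr_ge0.
have h6 : kappa * (e - m) <= kappa * n by rewrite ler_pM2l//; lra.
by rewrite ler_norml; apply/andP; split; lra.
Qed.

(** Along the segment from [f0] to [f1] the gap has quadratic increments, hence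
    is constant. *)
Lemma gap_resolvent_const kappa f0 f1 w0 w1 : 0 < kappa -> 2 * omega <= kappa ->
  resolvent_at kappa f0 w0 -> resolvent_at kappa f1 w1 -> gap w0 = gap w1.
Proof.
move=> k0 ok r0 r1.
have eq_gap f w w' : resolvent_at kappa f w -> resolvent_at kappa f w' -> gap w = gap w'.
  move=> rw rw'; have := gap_increment k0 rw' rw.
  by rewrite subrr normr0 expr0n mulr0 normr_le0 subr_eq0 => /eqP.
have [sel selP] := choice (fun s : R => resolvent_exists (f0 + s *: (f1 - f0)) k0 ok).
pose C := kappa * `|f1 - f0| ^+ 2.
have C0 : 0 <= C by exact: mulr_ge0 (ltW k0) (sqr_ge0 _).
have incr s t : `|gap (sel t) - gap (sel s)| <= C * (t - s) ^+ 2.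
  apply: le_trans (gap_increment k0 (selP s) (selP t)) _.
  rewrite opprD addrACA subrr add0r -scalerBl normrZ exprMn real_normK ?num_real//.
  by rewrite /C mulrCA mulrC.
have E0 : gap (sel 0) = gap w0.
  by apply: (eq_gap f0) => //; have := selP 0; rewrite scale0r addr0.
have E1 : gap (sel 1) = gap w1.
  by apply: (eq_gap f1) => //; have := selP 1; rewrite scale1r addrCA subrr addr0.
rewrite -E0 -E1; apply/le_anti/andP; split; rewrite -subr_le0.
  have := @quadratic_increment R (fun s => - gap (sel s)) 0 1 0 C C0 ler01.
  rewrite opprK addrC mul0r; apply=> s t _ st _.
  have := incr s t; rewrite ler_norml => /andP[h _]; lra.
have := @quadratic_increment R (fun s => gap (sel s)) 0 1 0 C C0 ler01.
rewrite mul0r; apply=> s t _ st _.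
by have := incr s t; rewrite ler_norml => /andP[_ h]; lra.
Qed.

Lemma gap_const : exists c : R, forall w y p, exact_minorant phi j w y p -> gap w = c.
Proof.
pose k := 2 * omega + 1.
have k0 : 0 < k by rewrite ltr_wpDl// mulr_ge0.
have ok : 2 * omega <= k by rewrite lerDl.
have [w0 r0] := resolvent_exists 0 k0 ok.
exists (gap w0) => w y p wy.
apply: (@gap_resolvent_const k (j w + k^-1 *: y) 0) => //; exists p.
by rewrite addrAC subrr add0r scalerA divff ?scale1r// gt_eqF.
Qed.

(** The hypothesis on [p] makes the resolvents [W k] at [u] satisfy
    [phi (W k) <= p] and forces [j (W k)] to converge to [u].  Lower
    semicontinuity of [phiH] then bounds [phiH u], and a weak cluster point of
    the [W k] lies in the fiber of [u]. *)
Lemma exact_minorant_approximation (c : R) u (p : R) :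
  (forall w y q, exact_minorant phi j w y q -> gap w = c) ->
  (forall w y q, exact_minorant phi j w y q -> q + L2dot y (u - j w) <= p) ->
  (phiH u <= (p - c)%:E)%E /\ exists2 v, j v = u & (phi v <= p%:E)%E.
Proof.
move=> gc hp; pose k0 := 2 * omega + 1.
have k00 : 0 < k0 by rewrite ltr_wpDl// mulr_ge0.
have ok0 : 2 * omega <= k0 by rewrite lerDl.
have [W WP] : exists W : R -> V, forall k, k0 <= k -> resolvent_at k u (W k).
  suff /choice[W WP] : forall k : R, exists w, k0 <= k -> resolvent_at k u w by exists W.
  move=> k.
  have [kk|kk] := leP k0 k; last by exists 0.
  have [||w rw] := @resolvent_exists k u; [exact: lt_le_trans kk|exact: le_trans kk|].
  by exists w.
have [p1 s1] := WP k0 (lexx _).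
(* One exact minorant bounds [phi] at all the [W k] from below by an affine
   function of [|u - j (W k)|]. *)
pose y1 := k0 *: (u - j (W k0)).
pose A := p1 + L2dot y1 (u - j (W k0)); pose B := `|y1|.
have est k : k0 <= k -> exists q, [/\ exact_minorant phi j (W k) (k *: (u - j (W k))) q,
    q + k * `|u - j (W k)| ^+ 2 <= p & A - B * `|u - j (W k)| <= q].
  move=> kk; have [q sq] := WP k kk; exists q; split=> //.
    by have := hp _ _ _ sq; rewrite L2dotZl -L2norm_sqr.
  have := s1.2 (W k); rewrite sq.1 lee_fin; apply: le_trans.
  rewrite /A -addrA lerD2l lerBlDr -lerBlDl -L2dotBr opprB addrA subrK.
  exact: L2_cauchy_schwarz.
have small e : 0 < e -> exists2 k1, k0 <= k1 & forall k, k1 <= k -> `|u - j (W k)| <= e.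
  move=> e0; pose M := `|p - A| / e + B.
  have M0 : 0 <= M by exact: addr_ge0 (divr_ge0 (normr_ge0 _) (ltW e0)) (normr_ge0 _).
  have Me0 : 0 <= M / e := divr_ge0 M0 (ltW e0).
  exists (k0 + M / e); first by rewrite lerDl.
  move=> k k1; have kk : k0 <= k by apply: le_trans k1; rewrite lerDl.
  have [q [_ q1 q2]] := est k kk; rewrite leNgt; apply/negP => er.
  move: q1 q2 er; set r := `|u - _| => q1 q2 er.
  have r0 : 0 < r by exact: lt_trans er.
  have k0' : 0 < k by exact: lt_le_trans kk.
  have h1 : k * r ^+ 2 <= M * r.
    apply: (@le_trans _ _ (p - A + B * r)); first lra.
    rewrite mulrDl lerD2r; apply: le_trans (ler_norm _) _.
    by rewrite mulrAC ler_pdivlMr// ler_wpM2l// ltW.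
  have h2 : k * r <= M by rewrite -(ler_pM2r r0) -mulrA -expr2.
  have h3 : k * e < M by apply: lt_le_trans h2; rewrite ltr_pM2l.
  have : k < M / e by rewrite ltr_pdivlMr.
  by rewrite ltNge; move: k1; have : 0 < k0 by []; lra.
have phiW k : k0 <= k -> (phi (W k) <= p%:E)%E.
  move=> kk; have [q [sq q1 _]] := est k kk; rewrite sq.1 lee_fin.
  have : 0 <= k * `|u - j (W k)| ^+ 2.
    by rewrite mulr_ge0 ?sqr_ge0// (le_trans (ltW k00)).
  by move=> ?; lra.
split.
  have [_ _ _ lH _] := phiHP; apply: (lH (p - c)) => U /nbhs_ballP[e/= e0 eU].
  have [k1 kk1 sm] := small (e / 2) ltac:(by rewrite divr_gt0).
  exists (j (W k1)); split; last first.
    by apply: eU; rewrite -ball_normE/=; apply: le_lt_trans (sm _ (lexx _)) _; lra.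
  have [q [sq q1 _]] := est k1 kk1; have [r sr] := exact_minorant_functional_on_H sq.
  have := gc _ _ _ sq; rewrite /gap sq.1/= sr.1/= lee_fin => <-.
  by have := phiW k1 kk1; rewrite sq.1 lee_fin; lra.
pose F : set_system (weak V) := [set S | exists k1, forall k, k1 <= k -> S (W k)].
have FF : ProperFilter F.
  split; first by move=> [k1 /(_ k1 (lexx _))].
  split; first by exists 0.
  - move=> S S' [k1 h1] [k2 h2]; exists (Num.max k1 k2) => k.
    by rewrite ge_max => /andP[kk1 kk2]; split; [exact: h1|exact: h2].
  - by move=> S S' SS' [k1 h1]; exists k1 => k /h1 /SS'.
have Fp : F [set v | (phi v <= p%:E)%E] by exists k0 => k /phiW.
have FK : F (closure ([set v | (phi v + (omega / 2 * `|j v| ^+ 2)%:E <=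
    (p + omega / 2 * (`|u| + 1) ^+ 2)%:E)%E] : set (weak V))).
  have [k1 kk1 sm] := small 1 ltr01; exists k1 => k kk.
  apply: (@subset_closure _ (_ : set (weak V))) => /=; rewrite EFinD; apply: leeD.
    exact/phiW/(le_trans kk1).
  rewrite lee_fin ler_wpM2l ?divr_ge0// ler_pXn2r ?nnegrE ?addr_ge0//.
  have -> : j (W k) = u - (u - j (W k)) by rewrite opprB addrCA subrr addr0.
  by apply: le_trans (ler_normB _ _) _; rewrite lerD2l sm.
have [v [_ vF]] := @phi_coercive _ F FF FK.
exists v; last by apply: sublevel_weakly_closed => S vS; exact: vF Fp vS.
apply/eqP; rewrite -subr_eq0 -normr_le0 leNgt; apply/negP => h0.
pose h := j v - u.
have [k1 kk1 sm] := small (`|h| / 2) ltac:(by rewrite divr_gt0).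
have nv : nbhs (v : weak V) [set w | L2dot (j v) h - `|h| ^+ 2 / 2 < L2dot (j w) h].
  apply: (@dot_weakly_continuous h v [set x | L2dot (j v) h - `|h| ^+ 2 / 2 < x]).
  by apply: lt_nbhsr; rewrite gtrBl divr_gt0// exprn_gt0.
have FS : F [set w | `|u - j w| <= `|h| / 2] by exists k1 => k /sm.
have [w [/= w1 w2]] := vF _ _ FS nv.
have := L2_cauchy_schwarz (j w - u) h; rewrite L2dotBl distrC => h1.
have : L2dot (j v) h - L2dot u h = `|h| ^+ 2 by rewrite -L2dotBl L2norm_sqr.
have : `|u - j w| * `|h| <= `|h| ^+ 2 / 2 by rewrite expr2 mulrAC ler_pM2r.
by move: h1 w2; lra.
Qed.

(** [exact_minorant_approximation] applies to [u = j v] with [p = phi v], the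
    exact minorants lying below [phi], and to any [u] with [p = phiH u + c], the
    exact minorants being common to [phi] and [phiH + c]. *)
Theorem functional_on_H_fiber_min : exists c : R,
  (forall v, (phiH (j v) + c%:E <= phi v)%E) /\
  (forall u, (phiH u < +oo)%E -> exists2 v, j v = u & (phi v <= phiH u + c%:E)%E).
Proof.
have [c gc] := gap_const; exists c; split=> [v|u uoo].
  have [->|voo] := eqVneq (phi v) +oo%E; first by rewrite leey.
  have [p vp] := ereal_real (phi_ninfty v) ltac:(by rewrite ltey).
  have [] := @exact_minorant_approximation c (j v) p gc.
    by move=> w y q sw; have := sw.2 v; rewrite vp lee_fin.
  rewrite vp => h _; apply: le_trans (leeD2r _ h) _.
  by rewrite -EFinD subrK.
have [nH _ _ _ _] := phiHP; have [q uq] := ereal_real (nH u) uoo.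
have [] := @exact_minorant_approximation c u (q + c) gc.
  move=> w y p sw; have [r sr] := exact_minorant_functional_on_H sw.
  have := sr.2 u; rewrite uq lee_fin/= => h.
  by have := gc _ _ _ sw; rewrite /gap sw.1/= sr.1/=; lra.
by move=> _ [v jv vp]; exists v => //; rewrite uq -EFinD.
Qed.

End FiberMinima.

(** * Truncation and envelope in $L^2$ *)

Section Excess.
Context (R : realType).
Implicit Types a b x y : R.

Definition excess a b := Num.max `|a| b - b.

Lemma excess_cases a b : (`|a| <= b /\ excess a b = 0) \/
  (b < `|a| /\ excess a b = `|a| - b).
Proof. by rewrite /excess; case: leP => ab; [left|right]; rewrite ?subrr. Qed.

Lemma sgr_cases a : [\/ 0 < a /\ Num.sg a = 1, a < 0 /\ Num.sg a = -1 | a = 0 /\ Num.sg a = 0].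
Proof.
have [a0|a0|->] := ltgtP a 0; [constructor 2|constructor 1|constructor 3].
- by rewrite ltr0_sg.
- by rewrite gtr0_sg.
- by rewrite sgr0.
Qed.

Lemma sub_min_sgE a b : a - Num.min `|a| b * Num.sg a = excess a b * Num.sg a.
Proof.
have aE : a = `|a| * Num.sg a by rewrite mulrC -numEsg.
rewrite {1}aE -mulrBl; congr (_ * _); rewrite /excess.
by case: (leP `|a| b) => _; rewrite ?subrr.
Qed.

Lemma excess_sg_dot a b x : excess a b * Num.sg a * x <= excess a b * `|x|.
Proof.
have := excess_cases a b => -[[_ ->]|[ab ->]]; first by rewrite !mul0r.
rewrite -mulrA ler_wpM2l ?subr_ge0 ?(ltW ab)//.
apply: le_trans (ler_norm _) _; rewrite normrM normr_sg.
by case: eqP => _; rewrite ?mul1r// mul0r.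
Qed.

(** Half the square of the excess is convex in [(a, b)], because the excess is the
    positive part of the convex function [|a| - b]. *)
Lemma excess_gradient a b x y :
  excess a b ^+ 2 / 2 - excess x y ^+ 2 / 2 <=
  (a - x) * (excess a b * Num.sg a) - (b - y) * excess a b.
Proof.
have h := excess_sg_dot a b x.
have a2 : a * Num.sg a = `|a| by rewrite mulrC -normrEsg.
have -> : (a - x) * (excess a b * Num.sg a) =
  excess a b * `|a| - excess a b * Num.sg a * x by rewrite -a2; ring.
move: h; set z := _ * x => h.
have [[ab E]|[ab E]] := excess_cases a b; have [[xy F]|[xy F]] := excess_cases x y;
  move: h ab xy; rewrite E F; move: (`|a|) (`|x|) => A X h ab xy;
  have := sqr_ge0 (A - b - (X - y)); have := sqr_ge0 (X - y);
  have := sqr_ge0 (A - b); nra.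
Qed.

Lemma excess_lipschitz a b x y :
  `|excess a b - excess x y| <= `|a - x| + `|b - y|.
Proof.
have h1 := ler_normB a x; have h2 := ler_dist_dist a x.
move: h2; rewrite !ler_norml => /andP[h3 h4].
have := ler_norm (b - y); have := ler_norm (- (b - y)); rewrite normrN => h5 h6.
have := normr_ge0 (a - x) => h7.
have [[ab ->]|[ab ->]] := excess_cases a b; have [[xy ->]|[xy ->]] := excess_cases x y;
  apply/andP; split; lra.
Qed.

(** For nonnegative thresholds this is soft thresholding: the jump of the sign
    is hidden where the excess vanishes. *)
Lemma signed_excess_lipschitz a b x y : 0 <= b -> 0 <= y ->
  `|excess a b * Num.sg a - excess x y * Num.sg x| <= `|a - x| + `|b - y|.
Proof.
move=> b0 y0.
have := ler_norm (b - y); have := ler_norm (- (b - y)); rewrite normrN => h5 h6.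
have := ler_norm (a - x); have := ler_norm (- (a - x)); rewrite normrN => h7 h8.
move: (`|a - x|) (`|b - y|) h5 h6 h7 h8 => N M h5 h6 h7 h8.
have [[a0 sa]|[a0 sa]|[a0 sa]] := sgr_cases a; have [[x0 sx]|[x0 sx]|[x0 sx]] := sgr_cases x;
have [[ab E]|[ab E]] := excess_cases a b; have [[xy F]|[xy F]] := excess_cases x y;
move: ab xy E F; rewrite sa sx ?(gtr0_norm a0) ?(ltr0_norm a0) ?(gtr0_norm x0) ?(ltr0_norm x0) ?a0 ?x0 ?normr0;
move=> ab xy -> ->; rewrite ler_norml; apply/andP; split; lra.
Qed.

End Excess.

Section L2Excess.
Context d (T : measurableType d) (R : realType) (mu : {measure set T -> \bar R}).
Local Notation H := (L2 mu).
Implicit Types u v w : H.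

Lemma L2dot_ge0_4 u1 v1 u2 v2 u3 v3 u4 v4 :
  {ae mu, forall x, 0 <= L2fun u1 x * L2fun v1 x + L2fun u2 x * L2fun v2 x +
    L2fun u3 x * L2fun v3 x + L2fun u4 x * L2fun v4 x} ->
  0 <= L2dot u1 v1 + L2dot u2 v2 + L2dot u3 v3 + L2dot u4 v4.
Proof.
move=> h; have := @L2dot_sum_ge0 _ T R mu 4
  (fun i => nth 0 [:: u1; u2; u3; u4] i) (fun i => nth 0 [:: v1; v2; v3; v4] i).
rewrite !big_ord_recl !big_ord0/= addr0 !addrA; apply.
by apply: ae_imply h => x; rewrite !big_ord_recl !big_ord0/= addr0 !addrA.
Qed.

Lemma L2dot_ge0_2 u1 v1 u2 v2 :
  {ae mu, forall x, 0 <= L2fun u1 x * L2fun v1 x + L2fun u2 x * L2fun v2 x} ->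
  0 <= L2dot u1 v1 + L2dot u2 v2.
Proof.
move=> h; have := @L2dot_ge0_4 u1 v1 u2 v2 0 0 0 0; rewrite !L2dot0l !addr0; apply.
by apply: ae_imply2 h (@L2fun0 _ T R mu) => x + ->; rewrite mul0r !addr0.
Qed.

Lemma L2absE u : {ae mu, forall x, L2fun (L2abs u) x = `|L2fun u x|}.
Proof. exact: mkL2E. Qed.

Definition truncation u v : H := L2mulsg (L2min (L2abs u) v) u.

Definition envelope u v : H := L2max (L2abs u) v.

Lemma truncationE u v : {ae mu, forall x, L2fun (truncation u v) x =
  Num.min `|L2fun u x| (L2fun v x) * Num.sg (L2fun u x)}.
Proof.
apply: ae_imply3 (mkL2E (Lfun2_mulsg (L2min (L2abs u) v) u))
  (mkL2E (Lfun2_min (L2abs u) v)) (L2absE u) => x h1 h2 h3.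
by rewrite [LHS]h1 [L2fun (L2min _ _) x]h2 h3.
Qed.

Lemma envelopeE u v : {ae mu, forall x, L2fun (envelope u v) x =
  Num.max `|L2fun u x| (L2fun v x)}.
Proof.
apply: ae_imply2 (mkL2E (Lfun2_max (L2abs u) v)) (L2absE u) => x h1 h3.
by rewrite [LHS]h1 h3.
Qed.

Lemma sub_truncationE u v : {ae mu, forall x, L2fun (u - truncation u v) x =
  excess (L2fun u x) (L2fun v x) * Num.sg (L2fun u x)}.
Proof.
apply: ae_imply2 (L2funB u (truncation u v)) (truncationE u v) => x -> ->.
exact: sub_min_sgE.
Qed.

Lemma envelope_subE u v : {ae mu, forall x, L2fun (envelope u v - v) x =
  excess (L2fun u x) (L2fun v x)}.
Proof. by apply: ae_imply2 (L2funB (envelope u v) v) (envelopeE u v) => x -> ->. Qed.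

Lemma L2norm_abs u : `|L2abs u| = `|u|.
Proof.
by apply/le_anti/andP; split; apply: L2norm_le; apply: ae_imply (L2absE u) => x ->;
  rewrite normr_id.
Qed.

Lemma L2norm_le_sum w u v :
  {ae mu, forall x, `|L2fun w x| <= `|L2fun u x| + `|L2fun v x|} ->
  `|w| <= `|u| + `|v|.
Proof.
move=> h; rewrite -(L2norm_abs u) -(L2norm_abs v).
apply: le_trans (ler_normD _ _); apply: L2norm_le.
have hh := ae_and (L2absE u) (L2absE v).
apply: ae_imply3 h hh (L2funD (L2abs u) (L2abs v)) => x h1 [h2 h3] h4.
by rewrite h4 h2 h3 [leRHS]ger0_norm ?addr_ge0.
Qed.

Lemma energy_gradient u1 u2 v1 v2 :
  `|envelope u1 u2 - u2| ^+ 2 / 2 - `|envelope v1 v2 - v2| ^+ 2 / 2 <=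
  L2dot (u1 - v1) (u1 - truncation u1 u2) + L2dot (u2 - v2) (u2 - envelope u1 u2).
Proof.
pose e := envelope u1 u2 - u2; pose f := envelope v1 v2 - v2.
have := @L2dot_ge0_4 (u1 - v1) (u1 - truncation u1 u2) (u2 - v2) (- e) (2^-1 *: f) f
  (- (2^-1 *: e)) e.
rewrite !(L2dotNl, L2dotNr, L2dotZl) -!L2norm_sqr -(opprB (envelope _ _)) L2dotNr -/e -/f.
move=> h; suff : 0 <= L2dot (u1 - v1) (u1 - truncation u1 u2) -
   L2dot (u2 - v2) e + 2^-1 * `|f| ^+ 2 - 2^-1 * `|e| ^+ 2 by lra.
apply: h.
have A := ae_and (L2funB u1 v1) (sub_truncationE u1 u2).
have B := ae_and (L2funB u2 v2) (envelope_subE u1 u2).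
have C := ae_and (L2funN e) (L2funZ 2^-1 f).
have D := ae_and (L2funN (2^-1 *: e)) (L2funZ 2^-1 e).
have E := ae_and A (ae_and B C).
apply: ae_imply3 E D (envelope_subE v1 v2) => x [[h1 h2] [[h3 h4] [h5 h6]]] [h7 h8] h9.
rewrite h5 h7 h6 h8 h1 h2 h3 h4 h9.
have := excess_gradient (L2fun u1 x) (L2fun u2 x) (L2fun v1 x) (L2fun v2 x).
by lra.
Qed.

Lemma envelope_sub_lipschitz u1 u2 v1 v2 :
  `|(envelope u1 u2 - u2) - (envelope v1 v2 - v2)| <= `|u1 - v1| + `|u2 - v2|.
Proof.
apply: L2norm_le_sum.
have A := ae_and (L2funB u1 v1) (L2funB u2 v2).
have B := ae_and (envelope_subE u1 u2) (envelope_subE v1 v2).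
apply: ae_imply3 A B (L2funB (envelope u1 u2 - u2) (envelope v1 v2 - v2)).
move=> x [h1 h2] [h3 h4] h5; rewrite h5 h3 h4 h1 h2; exact: excess_lipschitz.
Qed.

Lemma sub_truncation_lipschitz u1 u2 v1 v2 : L2le 0 u2 -> L2le 0 v2 ->
  `|(u1 - truncation u1 u2) - (v1 - truncation v1 v2)| <= `|u1 - v1| + `|u2 - v2|.
Proof.
move=> u20 v20; apply: L2norm_le_sum.
have A := ae_and (L2funB u1 v1) (L2funB u2 v2).
have B := ae_and (sub_truncationE u1 u2) (sub_truncationE v1 v2).
have C := ae_and u20 (ae_and v20 (@L2fun0 _ T R mu)).
have D := ae_and A C.
apply: ae_imply3 D B (L2funB (u1 - truncation u1 u2) (v1 - truncation v1 v2)).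
move=> x [[h1 h2] [h6 [h7 h8]]] [h3 h4] h5; rewrite h5 h3 h4 h1 h2.
by apply: signed_excess_lipschitz; rewrite -h8.
Qed.

Lemma envelope_sub_eq0 u v : envelope u v - v = 0 <-> L2le (L2abs u) v.
Proof.
split=> [h|h].
  have := envelope_subE u v; rewrite h => A.
  apply: ae_imply3 A (@L2fun0 _ T R mu) (L2absE u) => x h1 h2 ->.
  by move: h1; rewrite h2; case: (excess_cases (L2fun u x) (L2fun v x)) => -[? ->] ?; lra.
apply: L2_eq; have A := ae_and h (L2absE u).
apply: ae_imply3 (envelope_subE u v) (@L2fun0 _ T R mu) A => x -> -> [h1 h2]; rewrite h2 in h1.
by case: (excess_cases (L2fun u x) (L2fun v x)) => -[? ->] //; lra.
Qed.

End L2Excess.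

(** * Gradient curves *)

Section Trajectories.
Context d (T : measurableType d) (R : realType) (mu : {measure set T -> \bar R}).
Local Notation H := (L2 mu).
Local Notation leb := (@lebesgue_measure R).

(** A solution of $u' \in - \partial \psi(u)$, the inclusion being stated through
    exact minorants. *)
Definition gradient_curve (psi : H -> \bar R) (u0 : H) (u : R -> H) :=
  (forall e : R, 0 < e -> exists2 r : R, 0 < r &
    forall t, 0 <= t -> t < r -> `|u t - u0| <= e) /\
  exists g, has_weak_derivative u g /\
    {ae leb, forall t, 0 < t -> exists q : R,
      exact_minorant psi (idfun : {linear H -> H}) (u t) (- g t) q}.

Lemma dense_closure (A : set H) x : dense A -> closure A x.
Proof.
move=> dA B; rewrite nbhsE => -[U [opU Ux] UB].
have [y [Uy Ay]] : (U `&` A !=set0) by apply: dA => //; exists x.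
by exists y; split => //; exact: UB.
Qed.

Lemma within_ray_continuous (u : R -> H) : {within `[0, +oo[, continuous u} ->
  forall t, 0 <= t -> forall e : R, 0 < e -> exists2 r : R, 0 < r &
    forall s, 0 <= s -> `|s - t| < r -> `|u s - u t| <= e.
Proof.
move=> /subspace_continuousP cu t t0 e e0.
have := cu t; rewrite /= in_itv/= andbT => /(_ t0).
have nb : nbhs (u t) (ball (u t) e) by apply: nbhsx_ballx.
move=> /(_ _ nb); rewrite /within/= => /nbhs_ballP[r/= r0 h].
exists r => // s s0 st; have := h s; rewrite /ball/= distrC => /(_ st).
rewrite in_itv/= andbT s0 => /(_ isT) hs.
have : ball (u t) e (u s) by exact: hs.
by rewrite -ball_normE/= distrC => /ltW.
Qed.

Lemma semigroup_gradient_curve (V : tvsType R) (phi : V -> \bar R)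
    (j : {linear V -> H}) (phiH : H -> \bar R) (S : R -> H -> H) u0 :
  functional_on_H phi j phiH -> dense (j @` effdom phi) ->
  semigroup_generated_by phi j S -> gradient_curve phiH u0 (S^~ u0) /\ S 0 u0 = u0.
Proof.
move=> [nH cH _ _ sH] dj SP.
have [cu S0 [g [mg lg wd ae]]] := SP u0 (dense_closure dj).
have wc := within_ray_continuous cu.
split => //; split.
  move=> e e0; have [r r0 h] := wc 0 (lexx _) e e0; exists r => // t t0 tr.
  by have := h t t0; rewrite subr0 ger0_norm// S0; apply.
exists g; split.
  split => // t t0; apply/cvgrPdist_le => e e0.
  have [r r0 h] := wc t (ltW t0) e e0.
  apply/nbhs_ballP; exists (Num.min r t) => /=; first by rewrite lt_min r0.
  move=> s; rewrite /ball/= lt_min => /andP[s1 s2]; rewrite distrC.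
  apply: h; last by rewrite distrC.
  by move: s2; rewrite ltr_norml => /andP[_]; lra.
apply: ae_imply ae => t h /h /sH.
move=> /(@jsubgradient_exact_minorant _ _ _ _ H phiH idfun nH cH)[x [q [/= <- xq]]].
by exists q.
Qed.

Lemma half_sqr_le_dot (a b : H) : `|b| ^+ 2 / 2 - `|a| ^+ 2 / 2 <= L2dot (b - a) b.
Proof.
have := sqr_ge0 `|b - a|; rewrite L2norm_sqrB L2dotBl -L2norm_sqr (L2dotC a b); lra.
Qed.

Lemma lsc_sum_gap (psi1 psi2 : H -> \bar R) w1 w2 (r : R) :
  no_ninfty psi1 -> no_ninfty psi2 -> lsc psi1 -> lsc psi2 ->
  ~ (psi1 w1 + psi2 w2 <= r%:E)%E ->
  exists s1 s2 rho : R, [/\ r < s1 + s2, 0 < rho,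
    forall v, `|v - w1| <= rho -> (s1%:E < psi1 v)%E &
    forall v, `|v - w2| <= rho -> (s2%:E < psi2 v)%E].
Proof.
move=> n1 n2 l1 l2 /negP; rewrite -ltNge => h.
have [s1 [s2 [hs h1 h2]]] : exists s1 s2 : R,
    [/\ r < s1 + s2, (s1%:E < psi1 w1)%E & (s2%:E < psi2 w2)%E].
  move: h (n1 w1) (n2 w2); case: (psi1 w1) => [a| |//]; case: (psi2 w2) => [b| |//].
  - rewrite -EFinD lte_fin => h _ _; exists (a - (a + b - r) / 3), (b - (a + b - r) / 3).
    by rewrite !lte_fin; split; lra.
  - by move=> _ _ _; exists (a - 1), (r - a + 2); rewrite lte_fin ltry; split=> //; lra.
  - by move=> _ _ _; exists (r - b + 2), (b - 1); rewrite lte_fin ltry; split=> //; lra.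
  - by move=> _ _ _; exists (r + 1), 0; rewrite !ltry; split=> //; lra.
have nearby (psi : H -> \bar R) w (s : R) : lsc psi -> (s%:E < psi w)%E ->
    exists2 rho : R, 0 < rho & forall v, `|v - w| < rho -> (s%:E < psi v)%E.
  move=> lp sw; have : nbhs w (~` [set v | (psi v <= s%:E)%E]).
    apply: open_nbhs_nbhs; split; first by apply: closed_openC; exact: lp.
    by move=> /=; apply/negP; rewrite -ltNge.
  move=> /nbhs_ballP[rho/= rho0 hr]; exists rho => // v vw.
  have := hr v; rewrite -ball_normE/= distrC => /(_ vw)/negP.
  by rewrite -ltNge.
have [rho1 r10 hr1] := nearby _ _ _ l1 h1; have [rho2 r20 hr2] := nearby _ _ _ l2 h2.
pose rho := Num.min rho1 rho2 / 2.
have m0 : 0 < Num.min rho1 rho2 by rewrite lt_min r10.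
have rr1 : rho < rho1.
  by apply: (@lt_le_trans _ _ (Num.min rho1 rho2)); [rewrite /rho; lra|rewrite ge_min lexx].
have rr2 : rho < rho2.
  by apply: (@lt_le_trans _ _ (Num.min rho1 rho2)); [rewrite /rho; lra|rewrite ge_min lexx orbT].
exists s1, s2, rho; split => //; first by rewrite divr_gt0.
- by move=> v vw; apply: hr1; exact: le_lt_trans vw rr1.
- by move=> v vw; apply: hr2; exact: le_lt_trans vw rr2.
Qed.

Variables (psi1 psi2 : H -> \bar R).
Hypothesis n1 : no_ninfty psi1.
Hypothesis n2 : no_ninfty psi2.
Hypothesis l1 : lsc psi1.
Hypothesis l2 : lsc psi2.

(** Along the pair of curves started at [p], [|u - x|^2/2] with [x = p - e]
    decreases at a speed of at least [psi u - psi x], and lower semicontinuity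
    makes that speed positive near time 0 unless [psi p <= psi x]; but the
    obtuse angle condition keeps [|u - x|] at least [|p - x|]. *)
Lemma obtuse_angle_decreases p1 p2 e1 e2 u1 u2 :
  gradient_curve psi1 p1 u1 -> gradient_curve psi2 p2 u2 ->
  (forall t, 0 <= t -> 0 <= L2dot e1 (u1 t - p1) + L2dot e2 (u2 t - p2)) ->
  (psi1 p1 + psi2 p2 <= psi1 (p1 - e1)%R + psi2 (p2 - e2)%R)%E.
Proof.
move=> [near1 [g1 [ug1 sg1]]] [near2 [g2 [ug2 sg2]]] angle.
pose x1 := p1 - e1; pose x2 := p2 - e2; rewrite -/x1 -/x2.
have [r1E|r1oo] := eqVneq (psi1 x1) +oo%E.
  by rewrite r1E addye ?leey// gt_eqF.
have [r2E|r2oo] := eqVneq (psi2 x2) +oo%E.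
  by rewrite r2E addey ?leey// gt_eqF.
have [r1 r1E] := ereal_real (n1 x1) ltac:(by rewrite ltey).
have [r2 r2E] := ereal_real (n2 x2) ltac:(by rewrite ltey).
rewrite r1E r2E -EFinD; apply: contrapT => /(lsc_sum_gap n1 n2 l1 l2).
move=> [s1 [s2 [rho [rs rho0 h1 h2]]]].
have [d1 d10 near1'] := near1 rho rho0; have [d2 d20 near2'] := near2 rho rho0.
pose F (t : R) := `|u1 t - x1| ^+ 2 / 2 + `|u2 t - x2| ^+ 2 / 2.
pose eps := s1 + s2 - (r1 + r2).
have eps0 : 0 < eps by rewrite /eps; lra.
pose t := Num.min d1 d2 / 2.
have m0 : 0 < Num.min d1 d2 by rewrite lt_min d10.
have t0 : 0 < t by rewrite divr_gt0.
have td1 : t < d1.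
  by apply: (@lt_le_trans _ _ (Num.min d1 d2)); [rewrite /t; lra|rewrite ge_min lexx].
have td2 : t < d2.
  by apply: (@lt_le_trans _ _ (Num.min d1 d2)); [rewrite /t; lra|rewrite ge_min lexx orbT].
have E2 (a b x : H) : (a - x) - (b - x) = a - b by rewrite opprB addrA subrK.
have decr s : 0 < s -> s <= t -> F t - F s <= - eps * (t - s).
  move=> s0 st.
  apply: (@energy_increment_le _ T R mu u1 g1 u2 g2 F (fun r => u1 r - x1)
    (fun r => u2 r - x2) s t (- eps) 1 ug1 ug2 s0 st ler01).
  - move=> a b _ _ _; rewrite /F.
    have := half_sqr_le_dot (u1 a - x1) (u1 b - x1).
    have := half_sqr_le_dot (u2 a - x2) (u2 b - x2).
    by rewrite (E2 (u1 b) (u1 a) x1) (E2 (u2 b) (u2 a) x2); lra.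
  - move=> a b _ _ _; rewrite mul1r.
    rewrite (E2 (u1 b) (u1 a) x1) (E2 (u2 b) (u2 a) x2).
    by rewrite lerDl lerDr !normr_ge0.
  - apply: ae_imply2 sg1 sg2 => r sg1' sg2' /andP[sr rt].
    have r0 : 0 < r by exact: lt_le_trans sr.
    have [q1 [q1E Q1]] := sg1' r0; have [q2 [q2E Q2]] := sg2' r0.
    have := Q1 x1; have := Q2 x2; rewrite r1E r2E !lee_fin/=.
    have := h1 (u1 r) (near1' r (ltW r0) (le_lt_trans rt td1)).
    have := h2 (u2 r) (near2' r (ltW r0) (le_lt_trans rt td2)).
    rewrite q1E q2E !lte_fin /eps -(opprB (u1 r)) -(opprB (u2 r)).
    rewrite !L2dotNl !L2dotNr; lra.
pose F0 := `|e1| ^+ 2 / 2 + `|e2| ^+ 2 / 2.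
have FE s : F s = `|u1 s - p1| ^+ 2 / 2 + `|u2 s - p2| ^+ 2 / 2 +
    (L2dot e1 (u1 s - p1) + L2dot e2 (u2 s - p2)) + F0.
  have E (a p e : H) : a - (p - e) = (a - p) + e by rewrite opprB addrA addrAC.
  rewrite /F /x1 /x2 !E !L2norm_sqrD (L2dotC e1) (L2dotC e2) /F0; lra.
have F0t : F0 <= F t.
  rewrite FE; have := angle t (ltW t0).
  have := sqr_ge0 `|u1 t - p1|; have := sqr_ge0 `|u2 t - p2|; lra.
pose M := 1 + `|e1| + `|e2|.
have M0 : 0 < M.
  by rewrite /M; have := normr_ge0 e1; have := normr_ge0 e2; lra.
pose eta := Num.min 1 (eps * t / (4 * M)).
have et : 0 < eps * t by exact: mulr_gt0.
have eta0 : 0 < eta by rewrite lt_min ltr01 divr_gt0// mulr_gt0.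
have eta1 : eta <= 1 by rewrite ge_min lexx.
have etaM : eta * M <= eps * t / 4.
  have : eta <= eps * t / (4 * M) by rewrite ge_min lexx orbT.
  by rewrite !ler_pdivlMr// ?mulr_gt0//; lra.
have [a1 a10 n1'] := near1 eta eta0; have [a2 a20 n2'] := near2 eta eta0.
pose s := Num.min (t / 2) (Num.min a1 a2 / 2).
have am0 : 0 < Num.min a1 a2 by rewrite lt_min a10.
have s0 : 0 < s by rewrite lt_min !divr_gt0.
have sa : s <= Num.min a1 a2 / 2 by rewrite ge_min lexx orbT.
have st2 : s <= t / 2 by rewrite ge_min lexx.
have sa1 : s < a1.
  by apply: (@lt_le_trans _ _ (Num.min a1 a2)); [lra|rewrite ge_min lexx].
have sa2 : s < a2.
  by apply: (@lt_le_trans _ _ (Num.min a1 a2)); [lra|rewrite ge_min lexx orbT].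
have b1 := n1' s (ltW s0) sa1; have b2 := n2' s (ltW s0) sa2.
have := decr s s0 ltac:(lra).
have : F s <= F0 + eta * M.
  rewrite FE.
  have c1 := L2_cauchy_schwarz e1 (u1 s - p1).
  have c2 := L2_cauchy_schwarz e2 (u2 s - p2).
  have d1' : `|e1| * `|u1 s - p1| <= `|e1| * eta by rewrite ler_wpM2l.
  have d2' : `|e2| * `|u2 s - p2| <= `|e2| * eta by rewrite ler_wpM2l.
  have f1 : `|u1 s - p1| ^+ 2 <= eta.
    by have := normr_ge0 (u1 s - p1); move: b1; move: (`|u1 s - p1|) => z; nra.
  have f2 : `|u2 s - p2| ^+ 2 <= eta.
    by have := normr_ge0 (u2 s - p2); move: b2; move: (`|u2 s - p2|) => z; nra.
  by rewrite /M; lra.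
have : eps * (t - s) >= eps * (t / 2) by rewrite ler_pM2l//; lra.
by clear -F0t etaM et; lra.
Qed.

End Trajectories.

(** * Domination and the swap inequality *)

Section SwapInequality.
Context (R : realType).

Lemma ereal_sum_real (x y : \bar R) (r : R) : (-oo < x)%E -> (-oo < y)%E ->
  (x + y <= r%:E)%E -> exists a b : R, [/\ x = a%:E, y = b%:E & a + b <= r].
Proof.
case: x => [a| |//]; case: y => [b| |//] _ _; rewrite ?addye ?addey ?leye_eq//.
by rewrite -EFinD lee_fin => ab; exists a, b.
Qed.

(** The hypothesis is [f s - f (s - t) <= k (s + t) - k s], so a sum over equal
    steps telescopes.  Halving the interval repeatedly proves finiteness of the
    intermediate values at the same time, which the cancellations need. *)
Lemma dyadic_swap (f k : R -> \bar R) :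
  (forall s, (-oo < f s)%E) -> (forall s, (-oo < k s)%E) ->
  (forall s t, 0 <= s -> s <= 1 -> 0 <= t ->
    (f s + k s <= f (s - t)%R + k (s + t)%R)%E) ->
  forall n x y p q, 0 <= x -> x <= y -> y <= 1 -> f x = p%:E -> k y = q%:E ->
  exists p' q', [/\ f (y - (y - x) * 2^-1 ^+ n.+1) = p'%:E,
    k (x + (y - x) * 2^-1 ^+ n.+1) = q'%:E & p' + q' <= p + q].
Proof.
move=> nf nk Q.
have mid x y p q : 0 <= x -> x <= y -> y <= 1 -> f x = p%:E -> k y = q%:E ->
    exists p' q', [/\ f ((x + y) / 2) = p'%:E, k ((x + y) / 2) = q'%:E & p' + q' <= p + q].
  move=> x0 xy y1 fx ky.
  have := Q ((x + y) / 2) ((y - x) / 2) ltac:(lra) ltac:(lra) ltac:(lra).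
  have -> : (x + y) / 2 - (y - x) / 2 = x by lra.
  have -> : (x + y) / 2 + (y - x) / 2 = y by lra.
  rewrite fx ky -EFinD; exact: ereal_sum_real.
elim=> [|n ih] x y p q x0 xy y1 fx ky.
  rewrite expr1.
  have -> : y - (y - x) * 2^-1 = (x + y) / 2 by lra.
  have -> : x + (y - x) * 2^-1 = (x + y) / 2 by lra.
  exact: mid.
have [fc [kc [fcE kcE _]]] := mid x y p q x0 xy y1 fx ky.
pose c := (x + y) / 2; pose h := (y - x) * 2^-1 ^+ n.+2.
have xc : x <= c by rewrite /c; lra.
have cy : c <= y by rewrite /c; lra.
have h0 : 0 <= h by rewrite mulr_ge0 ?subr_ge0// exprn_ge0// invr_ge0.
have hx : (c - x) * 2^-1 ^+ n.+1 = h.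
  by rewrite /h /c [in RHS]exprS; move: (2^-1 ^+ n.+1) => z; field.
have hy : (y - c) * 2^-1 ^+ n.+1 = h.
  by rewrite /h /c [in RHS]exprS; move: (2^-1 ^+ n.+1) => z; field.
have := ih x c p kc x0 xc (le_trans cy y1) fx kcE; rewrite hx.
move=> [a [b [aE bE ab]]].
have := ih c y fc q (le_trans x0 xc) cy y1 fcE ky; rewrite hy.
move=> [a' [b' [aE' bE' ab']]].
have := Q c h (le_trans x0 xc) (le_trans cy y1) h0.
rewrite fcE kcE aE bE' -!EFinD lee_fin => cab.
by exists a', b; split => //; lra.
Qed.

(** The two factors form the displacement towards the boundary of the pairs with
    [|y1| <= y2], reached at a point [p] with [|p1| = p2] where the excess is positive; the
    angle with any other
    such pair is obtuse since [y2 - sign(a) y1 >= 0]. *)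
Lemma obtuse_angle (a b s y1 y2 : R) : 0 <= b -> 0 <= s -> s <= 1 -> `|y1| <= y2 ->
  0 <= - (excess a b * Num.sg a) * (y1 - (a - s * (excess a b * Num.sg a))) +
       excess a b * (y2 - (b + (1 - s) * excess a b)).
Proof.
move=> b0 s0 s1 yy.
have [[ab ->]|[ab ->]] := excess_cases a b; first by rewrite !mul0r oppr0 mul0r addr0.
have a0 : a != 0 by rewrite -normr_gt0 (le_lt_trans b0 ab).
have sg2 : Num.sg a * Num.sg a = 1 by rewrite -expr2 sqr_sg a0.
have sa : Num.sg a * a = `|a| by rewrite -normrEsg.
have sy : Num.sg a * y1 <= y2.
  by apply: le_trans yy; apply: le_trans (ler_norm _) _; rewrite normrM normr_sg a0 mul1r.
have -> : - ((`|a| - b) * Num.sg a) * (y1 - (a - s * ((`|a| - b) * Num.sg a))) +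
    (`|a| - b) * (y2 - (b + (1 - s) * (`|a| - b))) =
  (`|a| - b) * (y2 - Num.sg a * y1 + (Num.sg a * a - `|a|) +
     s * (`|a| - b) * (1 - Num.sg a * Num.sg a)) by ring.
by rewrite sg2 sa !subrr mulr0 !addr0 mulr_ge0// subr_ge0// ltW.
Qed.

Lemma segment_dominated (a b s : R) : 0 <= b -> 0 <= s -> s <= 1 ->
  `|a - s * (excess a b * Num.sg a)| <= b + (1 - s) * excess a b.
Proof.
move=> b0 s0 s1.
have [[ab ->]|[ab ->]] := excess_cases a b; first by rewrite mul0r !mulr0 subr0 addr0.
have -> : a - s * ((`|a| - b) * Num.sg a) = Num.sg a * (`|a| - s * (`|a| - b)).
  by have aE := numEsg a; rewrite {1}aE; ring.
rewrite normrM normr_sg.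
have -> : `| `|a| - s * (`|a| - b)| = `|a| - s * (`|a| - b).
  by apply: ger0_norm; nra.
have a0 : a != 0 by rewrite -normr_gt0 (le_lt_trans b0 ab).
by rewrite a0 mul1r; lra.
Qed.

End SwapInequality.

Section Domination.
Context d (T : measurableType d) (R : realType) (mu : {measure set T -> \bar R}).
Local Notation H := (L2 mu).
Local Notation leb := (@lebesgue_measure R).
Variables (psi1 psi2 : H -> \bar R) (S1 S2 : R -> H -> H).
Hypothesis n1 : no_ninfty psi1.
Hypothesis n2 : no_ninfty psi2.
Hypothesis l1 : lsc psi1.
Hypothesis l2 : lsc psi2.
Hypothesis curve1 : forall u, gradient_curve psi1 u (S1^~ u).
Hypothesis curve2 : forall u, gradient_curve psi2 u (S2^~ u).
Lemma L2le_trans (u v w : H) : L2le u v -> L2le v w -> L2le u w.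
Proof. by apply: ae_imply2 => x; exact: le_trans. Qed.

Lemma L2abs_ge0 (u : H) : L2le 0 (L2abs u).
Proof. by apply: ae_imply2 (@L2fun0 _ T R mu) (L2absE u) => x -> ->. Qed.

(** The squared norm of the excess does not increase, since its gradient is the
    displacement from the swapped pair and [psi1 + psi2] is not larger at the
    latter. *)
Lemma swap_dominated : positive_semigroup S2 -> (forall u1 u2 : H, L2le 0 u2 ->
    (psi1 (truncation u1 u2) + psi2 (envelope u1 u2) <= psi1 u1 + psi2 u2)%E) ->
  forall (t : R) (u : H), 0 < t -> L2le (L2abs (S1 t u)) (S2 t (L2abs u)).
Proof.
move=> S2_positive swap t u t0.
have [near1 [g1 [ug1 sg1]]] := curve1 u.
have [near2 [g2 [ug2 sg2]]] := curve2 (L2abs u).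
have pos s : 0 <= s -> L2le 0 (S2 s (L2abs u)).
  by move=> s0; apply: S2_positive => //; exact: L2abs_ge0.
pose G1 s := S1 s u - truncation (S1 s u) (S2 s (L2abs u)).
pose G2 s := S2 s (L2abs u) - envelope (S1 s u) (S2 s (L2abs u)).
pose E s := envelope (S1 s u) (S2 s (L2abs u)) - S2 s (L2abs u).
have GE s : G2 s = - E s by rewrite opprB.
pose F s := `|E s| ^+ 2 / 2.
have decr s : 0 < s -> s <= t -> F t - F s <= 0 * (t - s).
  move=> s0 st.
  apply: (@energy_increment_le _ T R mu (S1^~ u) g1 (S2^~ (L2abs u)) g2 F G1 G2 s t 0 1
    ug1 ug2 s0 st ler01).
  - by move=> a b _ _ _; exact: energy_gradient.
  - move=> a b sa ab _; rewrite mul1r.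
    have a0 : 0 <= a by exact: le_trans (ltW s0) sa.
    split; first exact: (sub_truncation_lipschitz _ _ (pos b (le_trans a0 ab)) (pos a a0)).
    by rewrite !GE opprK addrC -opprB normrN; exact: envelope_sub_lipschitz.
  - apply: ae_imply2 sg1 sg2 => r sg1' sg2' /andP[sr rt].
    have r0 : 0 < r by exact: lt_le_trans sr.
    have [q1 [q1E Q1]] := sg1' r0; have [q2 [q2E Q2]] := sg2' r0.
    have := swap (S1 r u) (S2 r (L2abs u)) (pos r (ltW r0)).
    rewrite q1E q2E -EFinD => /(ereal_sum_real (n1 _) (n2 _))[a [b [aE bE ab]]].
    have := Q1 (truncation (S1 r u) (S2 r (L2abs u))).
    have := Q2 (envelope (S1 r u) (S2 r (L2abs u))).
    rewrite aE bE !lee_fin /= /G1 /G2.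
    rewrite -(opprB (S1 r u)) -(opprB (S2 r (L2abs u))) !L2dotNl !L2dotNr; lra.
apply/envelope_sub_eq0/eqP; rewrite -normr_le0; apply/ler_addgt0Pr => e e0; rewrite add0r.
have [a1 a10 h1] := near1 (e / 2) ltac:(lra); have [a2 a20 h2] := near2 (e / 2) ltac:(lra).
pose s := Num.min t (Num.min a1 a2 / 2).
have am0 : 0 < Num.min a1 a2 by rewrite lt_min a10.
have s0 : 0 < s by rewrite lt_min t0 divr_gt0.
have st : s <= t by rewrite ge_min lexx.
have sa : s <= Num.min a1 a2 / 2 by rewrite ge_min lexx orbT.
have sa1 : s < a1.
  by apply: (@lt_le_trans _ _ (Num.min a1 a2)); [lra|rewrite ge_min lexx].
have sa2 : s < a2.
  by apply: (@lt_le_trans _ _ (Num.min a1 a2)); [lra|rewrite ge_min lexx orbT].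
have Es : `|E s| <= e.
  have E0 : envelope u (L2abs u) - L2abs u = 0.
    by apply/envelope_sub_eq0; apply: aeW => x.
  have := envelope_sub_lipschitz (S1 s u) (S2 s (L2abs u)) u (L2abs u).
  rewrite E0 subr0 -/(E s) => hE; apply: le_trans hE _.
  by have := h1 s (ltW s0) sa1; have := h2 s (ltW s0) sa2; lra.
have := decr s s0 st; rewrite mul0r subr_le0 /F ler_pM2r// => hF.
apply: le_trans _ Es; move: hF; rewrite ler_pXn2r// ?nnegrE//.
Qed.

Section Swap.
Hypothesis S2_order : order_preserving_on (positive_cone mu) S2.
Hypothesis dom : forall (t : R) (u : H), 0 <= t -> L2le (L2abs (S1 t u)) (S2 t (L2abs u)).
Variables (u1 u2 : H).
Hypothesis u20 : L2le 0 u2.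
Let e1 := u1 - truncation u1 u2.
Let e2 := envelope u1 u2 - u2.

(** The pair with parameter [s] on both segments is the projection, onto the
    pairs with [|y1| <= y2], of the pair with parameters [s - t] and [s + t]. *)
Lemma segment_swap (s t : R) : 0 <= s -> s <= 1 -> 0 <= t ->
  (psi1 (u1 - s *: e1)%R + psi2 (u2 + (1 - s) *: e2)%R <=
   psi1 (u1 - (s - t) *: e1)%R + psi2 (u2 + (1 - (s + t)) *: e2)%R)%E.
Proof.
move=> s0 s1 t0; pose p1 := u1 - s *: e1; pose p2 := u2 + (1 - s) *: e2.
have -> : u1 - (s - t) *: e1 = p1 - (- (t *: e1)).
  by rewrite /p1 opprK scalerBl opprB addrA addrAC.
have -> : u2 + (1 - (s + t)) *: e2 = p2 - t *: e2.
  by rewrite /p2 opprD addrA scalerBl addrA.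
have p1E : {ae mu, forall x, L2fun p1 x = L2fun u1 x -
    s * (excess (L2fun u1 x) (L2fun u2 x) * Num.sg (L2fun u1 x))}.
  apply: ae_imply3 (L2funB u1 (s *: e1)) (L2funZ s e1) (sub_truncationE u1 u2).
  by move=> x h1 h2 h3; rewrite h1 h2 h3.
have p2E : {ae mu, forall x, L2fun p2 x = L2fun u2 x +
    (1 - s) * excess (L2fun u1 x) (L2fun u2 x)}.
  apply: ae_imply3 (L2funD u2 ((1 - s) *: e2)) (L2funZ (1 - s) e2) (envelope_subE u1 u2).
  by move=> x h1 h2 h3; rewrite h1 h2 h3.
have u2p := ae_and u20 (@L2fun0 _ T R mu).
have C : L2le (L2abs p1) p2.
  apply: ae_imply3 (ae_and p1E p2E) u2p (L2absE p1) => x [h1 h2] [h3 h4] ->.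
  by rewrite h1 h2; apply: segment_dominated => //; rewrite -h4.
have p20 : L2le 0 p2 by exact: L2le_trans (L2abs_ge0 p1) C.
apply: (obtuse_angle_decreases n1 n2 l1 l2 (curve1 p1) (curve2 p2)) => r r0.
have SC : L2le (L2abs (S1 r p1)) (S2 r p2).
  apply: L2le_trans (dom p1 r0) _.
  by apply: S2_order => //; exact: L2abs_ge0.
rewrite L2dotNl !L2dotZl -mulrN -mulrDr mulr_ge0// -L2dotNl.
apply: L2dot_ge0_2.
have A := ae_and (L2funN e1) (ae_and (sub_truncationE u1 u2) (envelope_subE u1 u2)).
have B := ae_and (L2funB (S1 r p1) p1) (L2funB (S2 r p2) p2).
have D := ae_and SC (L2absE (S1 r p1)).
apply: ae_imply3 (ae_and A (ae_and p1E p2E)) (ae_and B D) u2p.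
move=> x [[h1 [h2 h3]] [h4 h5]] [[h6 h7] [h8 h9]] [h10 h11].
rewrite h1 h6 h7 h2 h3 h4 h5; apply: obtuse_angle => //; first by rewrite -h11.
by rewrite -h9.
Qed.

Lemma dominated_swap :
  (psi1 (truncation u1 u2) + psi2 (envelope u1 u2) <= psi1 u1 + psi2 u2)%E.
Proof.
have [r1E|r1oo] := eqVneq (psi1 u1) +oo%E.
  by rewrite r1E addye ?leey// gt_eqF.
have [r2E|r2oo] := eqVneq (psi2 u2) +oo%E.
  by rewrite r2E addey ?leey// gt_eqF.
have [r1 r1E] := ereal_real (n1 u1) ltac:(by rewrite ltey).
have [r2 r2E] := ereal_real (n2 u2) ltac:(by rewrite ltey).
rewrite r1E r2E -EFinD; apply: contrapT => /(lsc_sum_gap n1 n2 l1 l2).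
move=> [s1 [s2 [rho [rs rho0 h1 h2]]]].
pose f s := psi1 (u1 - s *: e1); pose k s := psi2 (u2 + (1 - s) *: e2).
have [n nrho] : exists n, 2^-1 ^+ n.+1 * (`|e1| + `|e2|) <= rho.
  exists (Num.bound ((`|e1| + `|e2|) / rho)); set n := Num.bound _.
  have : (`|e1| + `|e2|) / rho < n%:R.
    by apply: archi_boundP; rewrite divr_ge0 ?addr_ge0// ltW.
  have n2' : n%:R <= 2 ^+ n.+1 :> R.
    by rewrite -natrX ler_nat (leq_trans (ltnW (ltn_expl n (ltnSn 1))))// leq_exp2l.
  rewrite ltr_pdivrMr// => hn; rewrite exprVn ler_pdivrMl ?exprn_gt0//.
  by apply: le_trans (ltW hn) _; rewrite ler_wpM2r// ltW.
pose h : R := 2^-1 ^+ n.+1.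
have h0 : 0 <= h by rewrite exprn_ge0// invr_ge0.
have [|||||p [q [fp kq pq]]] := @dyadic_swap R f k (fun s => n1 (u1 - s *: e1))
  (fun s => n2 (u2 + (1 - s) *: e2))
  (fun s t s0 s1 t0 => segment_swap s0 s1 t0) n 0 1 r1 r2.
- exact: lexx.
- exact: ler01.
- exact: lexx.
- by rewrite /f scale0r subr0.
- by rewrite /k subrr scale0r addr0.
move: fp kq; rewrite subr0 mul1r add0r -/h => fp kq.
have := h1 (u1 - (1 - h) *: e1); have := h2 (u2 + (1 - h) *: e2).
rewrite -/(f (1 - h)) -/(k h) fp kq !lte_fin.
have -> : u2 + (1 - h) *: e2 - envelope u1 u2 = - (h *: e2).
  by rewrite scalerBl scale1r addrA [u2 + e2]addrC subrK addrAC subrr add0r.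
have -> : u1 - (1 - h) *: e1 - truncation u1 u2 = h *: e1.
  by rewrite scalerBl scale1r opprB addrAC -/e1 addrC subrK.
rewrite normrN !normrZ (ger0_norm h0).
have hle (e e' : H) : h * (`|e| + `|e'|) <= rho -> h * `|e| <= rho.
  by apply: le_trans; rewrite ler_wpM2l// lerDl.
move=> /(_ (hle e2 e1 _)) a /(_ (hle e1 e2 _)) b.
have := a ltac:(by rewrite addrC); have := b ltac:(by []).
by lra.
Qed.

End Swap.
End Domination.

Theorem corollary3p7 (R : realType) (d : measure_display) (Sigma : measurableType d)
  (mu : {measure set Sigma -> \bar R})
  (V1 V2 : tvsType R)
  (j1 : {linear V1 -> L2 mu}) (j2 : {linear V2 -> L2 mu})
  (phi1 : V1 -> \bar R) (phi2 : V2 -> \bar R)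
  (phi1H phi2H : L2 mu -> \bar R)
  (S1 S2 : R -> L2 mu -> L2 mu)
  (weak_j1 : weak_continuous j1) (weak_j2 : weak_continuous j2)
  (phi1_ninfty : no_ninfty phi1) (phi2_ninfty : no_ninfty phi2)
  (phi1_convex : econvex phi1) (phi2_convex : econvex phi2)
  (phi1_proper : eproper phi1) (phi2_proper : eproper phi2)
  (phi1_lsc : lsc phi1) (phi2_lsc : lsc phi2)
  (phi1_elliptic : j_elliptic phi1 j1) (phi2_elliptic : j_elliptic phi2 j2)
  (dense1 : dense (j1 @` effdom phi1)) (dense2 : dense (j2 @` effdom phi2))
  (phi1HP : functional_on_H phi1 j1 phi1H)
  (phi2HP : functional_on_H phi2 j2 phi2H)
  (S1P : semigroup_generated_by phi1 j1 S1)
  (S2P : semigroup_generated_by phi2 j2 S2)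
  (S2_positive : positive_semigroup S2)
  (S2_order : order_preserving_on (positive_cone mu) S2) :
  let assertion1 := semigroup_dominated S1 S2 in
  let assertion2 := forall u1 u2 : L2 mu, positive_cone mu u2 ->
    (phi1H (L2mulsg (L2min (L2abs u1) u2) u1) + phi2H (L2max (L2abs u1) u2)
      <= phi1H u1 + phi2H u2)%E in
  let assertion3 := forall (uh1 : V1) (uh2 : V2),
    effdom phi1 uh1 -> effdom phi2 uh2 -> positive_cone mu (j2 uh2) ->
    exists (vh1 : V1) (vh2 : V2),
      [/\ effdom phi1 vh1, effdom phi2 vh2,
          L2mulsg (L2min (L2abs (j1 uh1)) (j2 uh2)) (j1 uh1) = j1 vh1,
          L2max (L2abs (j1 uh1)) (j2 uh2) = j2 vh2 &
          (phi1 vh1 + phi2 vh2 <= phi1 uh1 + phi2 uh2)%E] in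
  (assertion1 <-> assertion2) /\ (assertion2 <-> assertion3).
Proof.
move=> assertion1 assertion2 assertion3.
have [n1 _ _ l1 _] := phi1HP; have [n2 _ _ l2 _] := phi2HP.
have c1 u := semigroup_gradient_curve u phi1HP dense1 S1P.
have c2 u := semigroup_gradient_curve u phi2HP dense2 S2P.
split; split.
- move=> [_ dom] u1 u2 u20.
  exact: (dominated_swap n1 n2 l1 l2 (fun u => (c1 u).1) (fun u => (c2 u).1) S2_order dom u1 u20).
- move=> swap; split=> // t u; rewrite le_eqVlt => /predU1P[<-|t0].
    by rewrite (c1 u).2 (c2 _).2; apply: aeW => x.
  exact: (swap_dominated n1 n2 (fun u => (c1 u).1) (fun u => (c2 u).1) S2_positive swap).
- have [om1 om10 [_ k1]] := phi1_elliptic; have [om2 om20 [_ k2]] := phi2_elliptic.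
  have [a1 [low1 min1]] := functional_on_H_fiber_min phi1_ninfty phi1_convex
    phi1_proper phi1_lsc weak_j1 om10 k1 phi1HP.
  have [a2 [low2 min2]] := functional_on_H_fiber_min phi2_ninfty phi2_convex
    phi2_proper phi2_lsc weak_j2 om20 k2 phi2HP.
  move=> swap uh1 uh2 d1 d2 pos.
  have [p1 p1E] := ereal_real (phi1_ninfty uh1) d1.
  have [p2 p2E] := ereal_real (phi2_ninfty uh2) d2.
  have := low1 uh1; have := low2 uh2; rewrite p1E p2E.
  move=> /(ereal_sum_real (n2 _) (ltNyr _))[q2 [c2' [q2E [<-] h2]]].
  move=> /(ereal_sum_real (n1 _) (ltNyr _))[q1 [c1' [q1E [<-] h1]]].
  have := swap (j1 uh1) (j2 uh2) pos; rewrite q1E q2E -EFinD.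
  move=> /(ereal_sum_real (n1 _) (n2 _))[b1 [b2 [b1E b2E hb]]].
  have [v1 jv1] := min1 _ (eq_ind_r (fun x => x < +oo)%E (ltry b1) b1E).
  have [v2 jv2] := min2 _ (eq_ind_r (fun x => x < +oo)%E (ltry b2) b2E).
  rewrite b1E b2E -!EFinD => hv2 hv1.
  exists v1, v2; split => //.
  - exact: le_lt_trans hv1 (ltry _).
  - exact: le_lt_trans hv2 (ltry _).
  - apply: le_trans (leeD hv1 hv2) _.
    by rewrite -!EFinD lee_fin; lra.
- have [om1 om10 [_ k1]] := phi1_elliptic; have [om2 om20 [_ k2]] := phi2_elliptic.
  have [a1 [low1 min1]] := functional_on_H_fiber_min phi1_ninfty phi1_convex
    phi1_proper phi1_lsc weak_j1 om10 k1 phi1HP.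
  have [a2 [low2 min2]] := functional_on_H_fiber_min phi2_ninfty phi2_convex
    phi2_proper phi2_lsc weak_j2 om20 k2 phi2HP.
  move=> lift u1 u2 u20.
  have [r1E|r1oo] := eqVneq (phi1H u1) +oo%E.
    by rewrite r1E addye ?leey// gt_eqF.
  have [r2E|r2oo] := eqVneq (phi2H u2) +oo%E.
    by rewrite r2E addey ?leey// gt_eqF.
  have [r1 r1E] := ereal_real (n1 u1) ltac:(by rewrite ltey).
  have [r2 r2E] := ereal_real (n2 u2) ltac:(by rewrite ltey).
  have [v1 jv1] := min1 u1 ltac:(by rewrite ltey).
  have [v2 jv2] := min2 u2 ltac:(by rewrite ltey).
  rewrite r1E r2E -!EFinD => hv2 hv1.
  have dv1 := le_lt_trans hv1 (ltry _); have dv2 := le_lt_trans hv2 (ltry _).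
  have := lift v1 v2 dv1 dv2; rewrite jv1 jv2 => /(_ u20)[w1 [w2 [_ _ -> -> hw]]].
  have := le_trans hw (leeD hv1 hv2); rewrite -EFinD.
  move=> /(ereal_sum_real (phi1_ninfty _) (phi2_ninfty _))[b1 [b2 [b1E b2E hb]]].
  have := low1 w1; have := low2 w2; rewrite b1E b2E.
  move=> /(ereal_sum_real (n2 _) (ltNyr _))[q2 [c2' [-> [<-] h2]]].
  move=> /(ereal_sum_real (n1 _) (ltNyr _))[q1 [c1' [-> [<-] h1]]].
  by rewrite -EFinD lee_fin; lra.
Qed.
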